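(* Let $m\ge1$ be an integer, let $\mathbf t=(t_0,\dots,t_{m-1})$ be an $m$-tuple of positive real numbers, and let $\Psi:\mathbb N\to[1,\infty)$ be a function. Define $B,b\in[0,\infty]$ by $$\log B=\liminf_{n\to\infty}\frac{\log\Psi(n)}{n},\qquad \log b=\liminf_{n\to\infty}\frac{\log\log\Psi(n)}{n},$$ and let $$\mathcal E_{\mathbf t}(\Psi)=\Big\{x\in[0,1):\ \prod_{i=0}^{m-1}a_{n+i}(x)^{t_i}\ge \Psi(n)\ \text{for infinitely many } n\in\mathbb N\Big\}.$$ Then the Hausdorff dimension of $\mathcal E_{\mathbf t}(\Psi)$ is $$\dim_{\mathrm H}\mathcal E_{\mathbf t}(\Psi)=\begin{cases}1 & \text{if } B=1,\\ \dfrac1{1+b} & \text{if } B=\infty,\end{cases}$$ where $\frac{1}{1+b}$ is read as $0$ when $b=\infty$.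
   Context: $\mathbb N=\{1,2,3,\dots\}$. For irrational $x\in[0,1)$, $a_1(x),a_2(x),\ldots\in\mathbb N$ denote the partial quotients of the regular continued fraction expansion $x=[a_1(x),a_2(x),\dots]=1/(a_1(x)+1/(a_2(x)+\cdots))$. Rational $x$ (a countable set) have finite expansions and are irrelevant to the statement. The values $\log B$ and $\log b$ may be $+\infty$, in which case $B=\infty$, respectively $b=\infty$. When $B=\infty$ one has $\Psi(n)>1$ for all large $n$, so $\log\log\Psi(n)$ is defined for all large $n$. *)

(* Defs.v *)
From HB Require Import structures.
From mathcomp Require Export all_boot all_order all_algebra.
From mathcomp Require Export all_classical all_reals all_analysis.
From mathcomp Require Import ring lra.

Set Implicit Arguments.
Unset Strict Implicit.
Unset Printing Implicit Defensive.

Import Order.TTheory GRing.Theory Num.Theory.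
Import numFieldNormedType.Exports.

Local Open Scope classical_set_scope.
Local Open Scope ring_scope.

Section ContinuedFractions.
Variable R : realType.
Implicit Types (x y : R) (s : seq nat).

(* On ]0, 1[ this is the fractional part of 1/x; since 0^-1 = 0, gauss_map 0 = 0. *)
Definition gauss_map x : R := x^-1 - (Num.truncn x^-1)%:R.

(* a_n(x), for n >= 1 and x irrational in [0, 1[. The value at n = 0 is
   meaningless. *)
Definition partial_quotient (n : nat) x : nat :=
  Num.truncn (iter n.-1 gauss_map x)^-1.

(* [:: a_1; ...; a_n] is sent to 1/(a_1 + 1/(a_2 + ... + 1/a_n)). *)
Definition cfrac s : R := foldr (fun a y => (a%:R + y)^-1) 0 s.

Definition convergent (n : nat) x : R :=
  cfrac [seq partial_quotient k x | k <- iota 1 n].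

Lemma gauss_map_irrational x :
  0 <= x < 1 -> irrational x ->
  [/\ 0 <= gauss_map x < 1, irrational (gauss_map x),
      (0 < partial_quotient 1 x)%N
    & x = ((partial_quotient 1 x)%:R + gauss_map x)^-1].
Proof.
move=> /andP[x0 x1] irx.
have x_gt0 : 0 < x.
  rewrite lt_neqAle x0 andbT; apply/eqP => x0E; apply: irx.
  by exists 0; rewrite // raddf0.
have v1 : 1 < x^-1 by rewrite invf_gt1.
have v0 : 0 <= x^-1 by rewrite invr_ge0.
have /andP[t1 t2] := Num.Theory.truncn_itv v0.
rewrite /partial_quotient /gauss_map /=; split.
- rewrite subr_ge0 t1 /= ltrBlDr; by move: t2; rewrite -natr1 addrC.
- move=> [q _ qE]; apply: irx; exists (q + (Num.truncn x^-1)%:R)^-1 => //.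
  by rewrite fmorphV rmorphD /= qE ratr_nat subrK invrK.
- by rewrite Num.Theory.truncn_gt0 ltW.
- by rewrite addrC subrK invrK.
Qed.

Lemma partial_quotientS n x :
  partial_quotient n.+2 x = partial_quotient n.+1 (gauss_map x).
Proof. by rewrite /partial_quotient /= -iterS iterSr. Qed.

Lemma partial_quotient_gt0 n x : 0 <= x < 1 -> irrational x ->
  (0 < n)%N -> (0 < partial_quotient n x)%N.
Proof.
case: n => // n x01 irx _.
elim: n x x01 irx => [|n IH] x x01 irx;
  have [Tx01 irTx a0 _] := gauss_map_irrational x01 irx => //.
by rewrite partial_quotientS IH.
Qed.

Lemma convergentS n x : convergent n.+1 x =
  ((partial_quotient 1 x)%:R + convergent n (gauss_map x))^-1.
Proof.
rewrite /convergent /=; congr (_ + cfrac _)^-1.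
rewrite (iotaDl 1 1) -map_comp.
apply/eq_in_map => -[|k]; first by rewrite mem_iota.
by move=> _ /=; rewrite add1n partial_quotientS.
Qed.

Lemma convergent_itv n x : 0 <= x < 1 -> irrational x ->
  0 <= convergent n x <= 1.
Proof.
elim: n x => [|n IH] x x01 irx; first by rewrite /convergent /= lexx ler01.
have [Tx01 irTx a0 _] := gauss_map_irrational x01 irx.
have /andP[c0 c1] := IH _ Tx01 irTx.
have a1 : 1 <= (partial_quotient 1 x)%:R :> R by rewrite ler1n.
have ac1 : 1 <= (partial_quotient 1 x)%:R + convergent n (gauss_map x) by lra.
by rewrite convergentS invr_ge0 (le_trans ler01 ac1) /= invf_le1 // (lt_le_trans ltr01 ac1).
Qed.

Lemma convergent_step n x : 0 <= x < 1 -> irrational x ->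
  `|x - convergent n.+1 x| <=
    x * `|gauss_map x - convergent n (gauss_map x)|.
Proof.
move=> x01 irx.
have [Tx01 irTx a0 xE] := gauss_map_irrational x01 irx.
have /andP[c0 c1] := convergent_itv n Tx01 irTx.
have /andP[cS0 cS1] := convergent_itv n.+1 x01 irx.
have /andP[x0 _] := x01; have /andP[T0 _] := Tx01.
have a1 : 1 <= (partial_quotient 1 x)%:R :> R by rewrite ler1n.
suff -> : x - convergent n.+1 x =
    - (x * convergent n.+1 x * (gauss_map x - convergent n (gauss_map x))).
  rewrite normrN !normrM (ger0_norm x0) (ger0_norm cS0).
  by rewrite ler_wpM2r // ler_piMr.
move: cS0 cS1; rewrite convergentS => _ _.
move: xE a1 c0 T0; move: (_%:R) (gauss_map x) (convergent _ _) => a y c -> *.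
have u0 : a + y != 0 by apply/lt0r_neq0; lra.
have v0 : a + c != 0 by apply/lt0r_neq0; lra.
by field; rewrite u0 v0.
Qed.

Lemma convergent_dist n x : 0 <= x < 1 -> irrational x ->
  `|x - convergent n.*2 x| <= 2^-1 ^+ n.
Proof.
elim: n x => [|n IH] x x01 irx.
  by rewrite /convergent /= subr0 expr0; case/andP: x01 => x0 x1; rewrite ger0_norm // ltW.
have [Tx01 irTx a0 xE] := gauss_map_irrational x01 irx.
have [TTx01 irTTx _ _] := gauss_map_irrational Tx01 irTx.
have /andP[x0 _] := x01; have /andP[T0 T1] := Tx01.
have a1 : 1 <= (partial_quotient 1 x)%:R :> R by rewrite ler1n.
rewrite doubleS; apply: le_trans (convergent_step _ x01 irx) _.
apply: le_trans (ler_wpM2l x0 (convergent_step _ Tx01 irTx)) _.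
rewrite mulrA exprS; apply: ler_pM => //; [exact: mulr_ge0| |exact: IH].
rewrite [X in X * _]xE; move: a1 T0 T1; move: (_%:R) (gauss_map x) => a y *.
by rewrite mulrC ler_pdivrMr; lra.
Qed.

(* The digits produced by the Gauss map are those of the expansion
   x = 1/(a_1(x) + 1/(a_2(x) + ...)). *)
Lemma cvg_convergent x : 0 <= x < 1 -> irrational x ->
  convergent n x @[n --> \oo] --> x.
Proof.
move=> x01 irx; apply/cvgrPdist_le => e e0.
have /cvgrPdist_le/(_ e e0)[N _ HN] :
    GRing.exp (2^-1 : R) n @[n --> \oo] --> (0 : R).
  by apply: cvg_expr; rewrite ger0_norm ?invr_ge0 // invf_lt1 // ltr1n.
exists N.*2.+1 => // n /= Nn.
have HE k : (N <= k)%N -> 2^-1 ^+ k <= e.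
  by move=> Nk; have := HN k Nk; rewrite sub0r normrN ger0_norm // exprn_ge0 ?invr_ge0.
have [x0 x1] := andP x01.
rewrite -(odd_double_half n).
case: (odd n) => /=.
  rewrite add1n; apply: le_trans (convergent_step _ x01 irx) _.
  have [Tx01 irTx _ _] := gauss_map_irrational x01 irx.
  rewrite -[leRHS]mul1r; apply: ler_pM => //; first exact: ltW.
  by apply: le_trans (convergent_dist _ Tx01 irTx) _; apply: HE; rewrite geq_half_double ltnW.
rewrite add0n; apply: le_trans (convergent_dist _ x01 irx) _.
by apply: HE; rewrite geq_half_double ltnW.
Qed.

End ContinuedFractions.

Section HausdorffDimension.
Variable R : realType.
Implicit Types (A U : set R) (s d : R).
Local Open Scope ereal_scope.

(* The maximum with 0 only serves to give the empty set diameter 0. *)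
Definition diam A : \bar R :=
  maxe 0 (ereal_sup [set `|x - y|%:E | x in A & y in A]).

(* |U|^s; in dimension 0, points have weight 0 `^ 0 = 1 and the empty set has
   weight 0. *)
Definition hausdorff_weight s U : \bar R :=
  if U == set0 then 0 else diam U `^ s.

(* Finite covers are included, as the members of a cover may be empty. *)
Definition hausdorff_content s d A : \bar R :=
  ereal_inf [set \sum_(0 <= i <oo) hausdorff_weight s (U i) |
    U in [set U : (set R)^nat |
      A `<=` \bigcup_i U i /\ forall i, diam (U i) <= d%:E]].

Definition hausdorff_measure s A : \bar R :=
  ereal_sup [set hausdorff_content s d A | d in [set d | (0 < d)%R]].

Definition hausdorff_dim A : \bar R :=
  ereal_inf [set s%:E | s in [set s | (0 <= s)%R /\ hausdorff_measure s A = 0]].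

End HausdorffDimension.

(* The set E_t(Psi), where Psi 0 plays no role. *)
Definition limsup_product_set (R : realType) (m : nat) (t : 'I_m -> R)
    (Psi : nat -> R) : set R :=
  [set x | [/\ 0 <= x < 1, irrational x
    & infinite_set [set n | (0 < n)%N /\
        Psi n <= \prod_(i < m) (partial_quotient (n + i) x)%:R `^ t i]]].

(* Main.v *)
Require Import Defs.
From mathcomp Require Import ring lra.
Import Order.TTheory GRing.Theory Num.Theory.
Import numFieldNormedType.Exports.
Set Implicit Arguments.
Unset Strict Implicit.
Unset Printing Implicit Defensive.
Local Open Scope classical_set_scope.
Local Open Scope ring_scope.

(** Lower bounds come from a mass distribution [v] on words of digits: it cuts
    [0, 1[ into nested intervals indexed by words, and sending a point of [0, 1[
    to the number with the corresponding digits inverts a Hölder map, so that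
    covers of the target pull back to covers of [0, 1[.  When B = oo and
    d > b, all digits are taken in [L_n, 2 L_n[ with L_n ~ exp(k d^n), and mass
    is distributed uniformly; these points lie in the limsup set because
    Psi(n) < exp(d^n) infinitely often.  When B = 1, the digits are at most M
    except at sparse positions where a large digit, of subexponential size, is
    prescribed; the mass of a word is the length of its cylinder times a factor
    which stays below exp(eta n).

    For the upper bound when B = oo, let P_n be the product of the first n
    digits.  If 1 + theta < b, or theta = 0, then for every A a point of the
    limsup set has infinitely many n with a_(n+1) >= A^(n+1) P_n^theta.  The
    points of a cylinder of order n with this property form a set of diameter
    at most A^-(n+1) P_n^-(2 + theta), and the sum of the s-th powers over all
    cylinders converges as soon as s (2 + theta) > 1 and A is large. *)

(** * Continuants and cylinders *)

Section Continuants.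
Variable R : realType.
Implicit Types (x y : R) (w : seq nat).

(** The inverse branch of an iterate of the Gauss map: the continued fraction with digits [w]
    followed by the tail [y]. *)
Definition mobius w y : R := foldr (fun a z => (a%:R + z)^-1) y w.

(** The denominators of the last two convergents, started from q_0 = 1 and q_(-1) = 0. *)
Definition continuants w : R * R :=
  foldl (fun p a => (a%:R * p.1 + p.2, p.1)) (1, 0) w.
Definition den w := (continuants w).1.
Definition den' w := (continuants w).2.

Local Notation posw := (all (leq 1)).

Lemma den_nil : den [::] = 1. Proof. by []. Qed.
Lemma den'_nil : den' [::] = 0. Proof. by []. Qed.

Lemma den_rcons w a : den (rcons w a) = a%:R * den w + den' w.
Proof. by rewrite /den /den' /continuants foldl_rcons. Qed.

Lemma den'_rcons w a : den' (rcons w a) = den w.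
Proof. by rewrite /den /den' /continuants foldl_rcons. Qed.

Lemma mobius_rcons w a y : mobius (rcons w a) y = mobius w (a%:R + y)^-1.
Proof. by rewrite /mobius foldr_rcons. Qed.

Lemma posw_rcons w a : posw (rcons w a) = (0 < a)%N && posw w.
Proof. by rewrite all_rcons. Qed.

Lemma den_bounds w : posw w -> [/\ 1 <= den w, 0 <= den' w & den' w <= den w].
Proof.
elim/last_ind: w => [|w a IH]; first by rewrite den_nil den'_nil.
rewrite posw_rcons den_rcons den'_rcons => /andP[a0 /IH[d1 d'0 d'd]].
have a1 : 1 <= a%:R :> R by rewrite ler1n.
by split; nra.
Qed.

Lemma den_prod w : posw w ->
  \prod_(a <- w) a%:R <= den w <= \prod_(a <- w) a.+1%:R.
Proof.
elim/last_ind: w => [|w a IH]; first by rewrite !big_nil den_nil lexx.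
rewrite posw_rcons => /andP[a0 pw]; have /andP[l u] := IH pw.
have [d1 d'0 d'd] := den_bounds pw.
have a1 : 1 <= a%:R :> R by rewrite ler1n.
rewrite -cats1 !big_cat !big_seq1 /= cats1 den_rcons -natr1; apply/andP; split.
  rewrite [leLHS]mulrC; apply: le_trans (ler_wpM2l _ l) _; lra.
have : (a%:R + 1) * den w <= (a%:R + 1) * \prod_(i <- w) i.+1%:R.
  by apply: ler_wpM2l => //; lra.
lra.
Qed.

(** The right side is the reciprocal of the length of the cylinder of [w]. It at least doubles with
    each digit: the new [den] is at least [den w + den' w], and the new sum is at least
    [2 * den w]. *)
Lemma expn2_den w : posw w -> 2 ^+ size w <= den w * (den w + den' w).
Proof.
elim/last_ind: w => [|w a IH]; first by rewrite den_nil den'_nil /=; lra.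
rewrite posw_rcons => /andP[a0 pw]; have := IH pw.
have [d1 d'0 d'd] := den_bounds pw.
have a1 : 1 <= a%:R :> R by rewrite ler1n.
rewrite size_rcons exprS den_rcons den'_rcons => h.
have h1 : den w + den' w <= a%:R * den w + den' w by nra.
have h2 : 2 * den w <= a%:R * den w + den' w + den w by nra.
apply: le_trans (_ : (den w + den' w) * (2 * den w) <= _); first by nra.
by apply: ler_pM => //; lra.
Qed.

(** [mobius w] is a fractional linear map of determinant 1 or -1 with denominator
    [den w + y * den' w]. Induction on the last digit avoids introducing numerators. *)
Lemma mobius_dist w y z : posw w -> 0 <= y -> 0 <= z ->
  `|mobius w y - mobius w z| =
  `|y - z| / ((den w + y * den' w) * (den w + z * den' w)).
Proof.
elim/last_ind: w y z => [|w a IH] y z.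
  by rewrite den_nil den'_nil !mulr0 addr0 mulr1 divr1.
rewrite posw_rcons => /andP[a0 pw] y0 z0.
have a1 : 1 <= a%:R :> R by rewrite ler1n.
have [d1 d'0 d'd] := den_bounds pw.
rewrite !mobius_rcons IH // ?invr_ge0; [|lra..].
rewrite den_rcons den'_rcons.
have h1 : 0 < a%:R + y by lra.
have h2 : 0 < a%:R + z by lra.
have -> : (a%:R + y)^-1 - (a%:R + z)^-1 = - ((y - z) / ((a%:R + y) * (a%:R + z))).
  by field; lra.
rewrite normrN normrM [`|_^-1|]ger0_norm ?invr_ge0 ?mulr_ge0 ?ltW //.
field.
have t1 : 0 < (a%:R + y) * den w by rewrite mulr_gt0 //; lra.
have t2 : 0 < (a%:R + z) * den w by rewrite mulr_gt0 //; lra.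
by rewrite !lt0r_neq0 //; lra.
Qed.

Definition prefix_word n x := [seq partial_quotient k x | k <- iota 1 n].

Lemma size_prefix_word n x : size (prefix_word n x) = n.
Proof. by rewrite size_map size_iota. Qed.

Lemma prefix_wordS n x :
  prefix_word n.+1 x = rcons (prefix_word n x) (partial_quotient n.+1 x).
Proof.
by rewrite /prefix_word -(addn1 n) iotaD map_cat /= cats1 add1n addn1.
Qed.

Lemma prefix_word_mkseq n x (a : nat -> nat) :
  (forall k, partial_quotient k.+1 x = a k) -> prefix_word n x = mkseq a n.
Proof.
move=> xa; elim: n => // n IH.
by rewrite prefix_wordS IH xa mkseqS.
Qed.

Lemma iter_gauss x n : 0 <= x < 1 -> irrational x ->
  0 <= iter n (@gauss_map R) x < 1 /\ irrational (iter n (@gauss_map R) x).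
Proof.
move=> x01 irx; elim: n => // n [h1 h2] /=.
by have [] := gauss_map_irrational h1 h2.
Qed.

Lemma iter_gaussE x n : 0 <= x < 1 -> irrational x ->
  iter n (@gauss_map R) x =
  ((partial_quotient n.+1 x)%:R + iter n.+1 (@gauss_map R) x)^-1.
Proof.
move=> x01 irx; have [h1 h2] := iter_gauss n x01 irx.
by have [_ _ _ {1}->] := gauss_map_irrational h1 h2.
Qed.

Lemma posw_prefix_word n x : 0 <= x < 1 -> irrational x -> posw (prefix_word n x).
Proof.
move=> x01 irx; elim: n => // n IH.
by rewrite prefix_wordS posw_rcons IH partial_quotient_gt0.
Qed.

Lemma mobius_prefix_word n x : 0 <= x < 1 -> irrational x ->
  x = mobius (prefix_word n x) (iter n (@gauss_map R) x).
Proof.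
move=> x01 irx; elim: n => // n IH.
by rewrite prefix_wordS mobius_rcons -iter_gaussE.
Qed.

(** The difference of the complete quotients is kept in the numerator: when a' = a + 1 it can be
    small, and each application bounds it below through the next digit of [x] or of [y]. *)
Lemma prefix_gap n x y (w := prefix_word n x)
    (a := partial_quotient n.+1 x) (a' := partial_quotient n.+1 y) :
  0 <= x < 1 -> irrational x -> 0 <= y < 1 -> irrational y ->
  prefix_word n y = w -> (a < a')%N ->
  ((a'%:R + iter n.+1 (@gauss_map R) y) - (a%:R + iter n.+1 (@gauss_map R) x))
    / (4 * den w ^+ 2 * a.+1%:R * a'.+1%:R) <= `|x - y|.
Proof.
move=> x01 irx y01 iry wE aa'.
have pw : posw w by exact: posw_prefix_word.
have [d1 d'0 d'd] := den_bounds pw.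
have -> : x - y = mobius w (a%:R + iter n.+1 (@gauss_map R) x)^-1
    - mobius w (a'%:R + iter n.+1 (@gauss_map R) y)^-1.
  rewrite -iter_gaussE // -(iter_gaussE n y01) //.
  by rewrite -[in RHS]mobius_prefix_word // -wE -mobius_prefix_word.
have [/andP[u0 u1] _] := iter_gauss n.+1 x01 irx.
have [/andP[v0 v1] _] := iter_gauss n.+1 y01 iry.
have a1 : 1 <= a%:R :> R by rewrite ler1n partial_quotient_gt0.
have a'1 : 1 + a%:R <= a'%:R :> R by rewrite -(natrD _ 1) ler_nat.
rewrite -/a -/a'; move: (iter _ _ x) (iter _ _ y) u0 u1 v0 v1 => u v *.
have au : 0 < a%:R + u by lra.
have av : 0 < a'%:R + v by lra.
rewrite mobius_dist //; [|by rewrite invr_ge0 ltW..].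
have -> : (a%:R + u)^-1 - (a'%:R + v)^-1 =
   (a'%:R + v - (a%:R + u)) / ((a%:R + u) * (a'%:R + v)) by field; lra.
have num0 : 0 <= a'%:R + v - (a%:R + u) by lra.
rewrite ger0_norm; last by rewrite divr_ge0 // ltW // mulr_gt0.
rewrite -[leRHS]mulrA; apply: ler_wpM2l => //.
have iu : 0 < (a%:R + u)^-1 <= 1 by rewrite invr_gt0 au invf_le1 //=; lra.
have iv : 0 < (a'%:R + v)^-1 <= 1 by rewrite invr_gt0 av invf_le1 //=; lra.
have q1 z : 0 < z <= 1 -> 0 < den w + z * den' w <= 2 * den w.
  by move=> /andP[z0 z1]; apply/andP; split; nra.
have /andP[e0 e1] := q1 _ iu; have /andP[f0 f1] := q1 _ iv.
rewrite -invfM lef_pV2 ?posrE ?mulr_gt0 ?exprn_gt0 //; try lra.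
rewrite -(mulrA (4 * den w ^+ 2)) mulrC; apply: ler_pM.
- by rewrite mulr_ge0 // ltW.
- by rewrite mulr_ge0 // ltW.
- rewrite (_ : 4 * den w ^+ 2 = (2 * den w) * (2 * den w)); last by ring.
  by apply: ler_pM => //; exact: ltW.
- by rewrite -!natr1; apply: ler_pM; lra.
Qed.

End Continuants.

(** * Points with prescribed partial quotients *)

Section DigitSequences.
Variables (R : realType) (a : nat -> nat).
Hypothesis a_gt0 : forall n, (0 < a n)%N.

Lemma mobius_itv (w : seq nat) (y : R) : all (leq 1) w -> 0 <= y <= 1 ->
  0 <= mobius w y <= 1.
Proof.
elim: w => //= b w IH /andP[b0 pw] y01.
have /andP[m0 m1] := IH pw y01.
have b1 : 1 <= b%:R :> R by rewrite ler1n.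
have bm : 1 <= b%:R + mobius w y by lra.
by rewrite invr_ge0 (le_trans ler01 bm) /= invf_le1 // (lt_le_trans ltr01 bm).
Qed.

Let tail k n : R := mobius (mkseq (fun i => a (k + i)%N) n) 0.

Let posw_tail k n : all (leq 1) (mkseq (fun i => a (k + i)%N) n).
Proof. by apply/allP => b /mapP[i _ ->]. Qed.

Let tail_itv k n : 0 <= tail k n <= 1.
Proof. by apply: mobius_itv; rewrite // lexx ler01. Qed.

Let tailS k n : tail k n.+1 = ((a k)%:R + tail k.+1 n)^-1.
Proof.
rewrite /tail /mkseq /= addn0; congr (_ + mobius _ _)^-1.
rewrite (iotaDl 1 0) -map_comp; apply: eq_map => i /=.
by rewrite add1n addnS addSn.
Qed.

(** Both truncations are images of points of [0, 1] under the same [mobius w], where [w] consists of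
    the n common digits, so the growth of continuants makes the truncations a Cauchy sequence. *)
Let tail_dist k n m : (n <= m)%N -> `|tail k n - tail k m| <= 2 / 2 ^+ n.
Proof.
move=> nm; set w := mkseq (fun i => a (k + i)%N) n.
have [v pv ->] : exists2 v, all (leq 1) v & tail k m = mobius w (mobius v 0).
  exists (drop n (mkseq (fun i => a (k + i)%N) m)).
    by apply/allP => b /mem_drop; apply/allP.
  rewrite /mobius -foldr_cat -/(mobius _ _) (_ : w = take n (mkseq (fun i => a (k + i)%N) m)).
    by rewrite cat_take_drop.
  by rewrite -map_take take_iota (minn_idPl nm).
have /andP[y0 y1] : 0 <= mobius v (0 : R) <= 1 by apply: mobius_itv; rewrite // lexx ler01.
have pw : all (leq 1) w by exact: posw_tail.
have [d1 d'0 d'd] := den_bounds R pw.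
have := expn2_den R pw; rewrite size_mkseq => h.
rewrite mobius_dist // sub0r normrN (ger0_norm y0) mul0r addr0.
have q0 : 0 < den R w * (den R w + mobius v 0 * den' R w).
  by apply: mulr_gt0; nra.
rewrite ler_pdivrMr // mulrAC ler_pdivlMr ?exprn_gt0 //.
have t0 : 0 < (2 : R) ^+ n by rewrite exprn_gt0.
have h2 : den R w * (den R w + den' R w) <=
  2 * (den R w * (den R w + mobius v 0 * den' R w)).
  rewrite mulrCA; apply: ler_wpM2l; first lra.
  have : 0 <= mobius v (0 : R) * den' R w by rewrite mulr_ge0.
  lra.
by apply: le_trans (le_trans h h2); rewrite -[leRHS]mul1r; apply: ler_wpM2r => //; exact: ltW.
Qed.

Let tail_cvg k : cvgn (tail k).
Proof.
apply/cauchy_cvgP/cauchy_exP => e e0.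
have : (2 * 2^-1 ^+ n : R) @[n --> \oo] --> (2 * 0 : R).
  by apply: cvgMr; apply: cvg_expr; rewrite ger0_norm ?invr_ge0 // invf_lt1 // ltr1n.
rewrite mulr0 => /cvgrPdist_lt/(_ e e0)[N _ HN].
exists (tail k N); exists N => // n /= Nn.
apply: le_lt_trans (tail_dist k Nn) _.
have := HN N (leqnn N); rewrite sub0r normrN ger0_norm ?exprVn //.
Qed.

Let X k : R := limn (tail k).

Let X_ge0 k : 0 <= X k.
Proof.
apply: limr_ge; first exact: tail_cvg.
by apply: nearW => n; case/andP: (tail_itv k n).
Qed.

(** The limit of [tailS]. It identifies [a k] as the integer part of the inverse of [X k], and
    [X k.+1] as the image of [X k] under the Gauss map. *)
Let XE k : X k = ((a k)%:R + X k.+1)^-1.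
Proof.
have h1 : tail k n.+1 @[n --> \oo] --> X k by rewrite (cvg_shiftS (tail k)); exact: tail_cvg.
have h2 : tail k n.+1 @[n --> \oo] --> ((a k)%:R + X k.+1)^-1.
  under eq_cvg do rewrite tailS.
  apply: cvgV.
    by rewrite lt0r_neq0 // ltr_wpDr // ltr0n.
  by apply: cvgD; [exact: cvg_cst|exact: tail_cvg].
exact: (cvg_unique _ h1 h2).
Qed.

Let X_itv k : 0 < X k < 1.
Proof.
have a1 j : 1 <= (a j)%:R :> R by rewrite ler1n.
have X0 j : 0 < X j by rewrite XE invr_gt0; have := X_ge0 j.+1; have := a1 j; lra.
rewrite X0 XE invf_lt1; have := X0 k.+1; have := a1 k; lra.
Qed.

Let truncn_X k : Num.truncn (X k)^-1 = a k.
Proof.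
rewrite XE invrK; apply: truncn_def.
by have /andP[x0 x1] := X_itv k.+1; rewrite -natr1; apply/andP; split; lra.
Qed.

Let gauss_X k : gauss_map (X k) = X k.+1.
Proof. by rewrite /gauss_map truncn_X XE invrK addrC addKr. Qed.

(* Infinite descent: the Gauss map lowers the denominator of a rational. *)
Let X_not_frac D N k : (0 < D)%N -> X k * D%:R = N%:R -> False.
Proof.
elim: D {-2}D (leqnn D) N k => [|D0 IH] D DD N k D0' XD.
  by move: DD; rewrite leqNgt D0'.
have /andP[x0 x1] := X_itv k.
have D0R : 0 < D%:R :> R by rewrite ltr0n.
have ND : (N < D)%N by rewrite -(ltr_nat R) -XD gtr_pMl.
have N0 : (0 < N)%N by rewrite -(ltr_nat R) -XD mulr_gt0.
have XN : X k.+1 * N%:R = D%:R - (a k * N)%:R.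
  have : (a k)%:R + X k.+1 = (X k)^-1 by rewrite [in RHS]XE invrK.
  move=> h; rewrite natrM -XD; have -> : X k.+1 = (X k)^-1 - (a k)%:R by rewrite -h addrC addKr.
  by field; lra.
have aND : (a k * N <= D)%N.
  rewrite -(ler_nat R) -subr_ge0 -XN mulr_ge0 //.
apply: (IH N _ (D - a k * N)%N k.+1 N0); first by rewrite -ltnS (leq_trans ND).
by rewrite natrB.
Qed.

Lemma digit_sequence_realized : exists x : R, [/\ 0 <= x < 1, irrational x
  & forall n, partial_quotient n.+1 x = a n].
Proof.
have iterX n : iter n (@gauss_map R) (X 0) = X n.
  by elim: n => //= n ->.
exists (X 0); split.
- by have /andP[/ltW -> ->] := X_itv 0.
- move=> [q _ qX].
  have q0 : 0 < q by have /andP[+ _] := X_itv 0; rewrite -qX ltr0q.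
  apply: (@X_not_frac `|denq q|%N `|numq q|%N 0); first by rewrite absz_gt0 denq_eq0.
  rewrite -qX !natr_absz.
  have -> : `|denq q| = denq q by rewrite gtr0_norm.
  have -> : `|numq q| = numq q by rewrite gtr0_norm // numq_gt0.
  by rewrite -{1}(divq_num_den q) rmorphM /= fmorphV /= !ratr_int divfK // intr_eq0 denq_eq0.
- by move=> n; rewrite /partial_quotient /= iterX truncn_X.
Qed.

End DigitSequences.

(** * Hausdorff dimension *)

Section DimensionBounds.
Variable R : realType.
Implicit Types (U E : set R) (s r c : R).
Local Open Scope ereal_scope.

Lemma diam_ge0 U : 0 <= diam U.
Proof. by rewrite /diam le_max lexx. Qed.

Lemma le_diam U x y : U x -> U y -> `|x - y|%:E <= diam U.
Proof.
move=> Ux Uy; rewrite /diam le_max; apply/orP; right.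
by apply: ereal_sup_ubound; exists x => //; exists y.
Qed.

Lemma diam_le U r : (0 <= r)%R ->
  (forall x y, U x -> U y -> (`|x - y| <= r)%R) -> diam U <= r%:E.
Proof.
move=> r0 Ur; rewrite /diam ge_max lee_fin r0 /=.
by apply: ge_ereal_sup => _ [x Ux [y Uy <-]]; rewrite lee_fin; exact: Ur.
Qed.

Lemma hausdorff_weight_ge0 s U : 0 <= hausdorff_weight s U.
Proof. by rewrite /hausdorff_weight; case: ifP => // _; exact: poweR_ge0. Qed.

Lemma hausdorff_weight_le s r U : (0 <= s)%R -> (0 <= r)%R ->
  diam U <= r%:E -> hausdorff_weight s U <= (r `^ s)%:E.
Proof.
move=> s0 r0 Ur; rewrite /hausdorff_weight; case: ifP => _.
  by rewrite lee_fin powR_ge0.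
rewrite -poweR_EFin; apply: gt0_ler_poweR => //.
- by rewrite in_itv /= diam_ge0 leey.
- by rewrite in_itv /= lee_fin r0 leey.
Qed.

Lemma hausdorff_weight_decr s r U : (0 <= r <= s)%R -> diam U <= 1 ->
  hausdorff_weight s U <= hausdorff_weight r U.
Proof.
move=> /andP[r0 rs] U1; rewrite /hausdorff_weight; case: ifP => // _.
have := diam_ge0 U; case: (diam U) U1 => [d| |] //.
rewrite !lee_fin => d1 d0; rewrite ?poweR_EFin ?lee_fin.
move: d0; rewrite le_eqVlt => /predU1P[<-|d0].
  have [s0|s0] := eqVneq s 0%R.
    by have -> : r = s by lra.
  by rewrite powR0 // powR_ge0.
by apply: ger_powR => //; rewrite d0.
Qed.

(** A bound on the content at scale 1 suffices: for r < s, sets of diameter at most 1 weigh at least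
    as much in dimension r, so the r-dimensional measure cannot vanish. *)
Lemma hausdorff_dim_ge E s c : (0 < c)%R ->
  (forall U : (set R)^nat, E `<=` \bigcup_i U i -> (forall i, diam (U i) <= 1) ->
    c%:E <= \sum_(0 <= i <oo) hausdorff_weight s (U i)) ->
  s%:E <= hausdorff_dim E.
Proof.
move=> c0 Hc; apply: le_ereal_inf_tmp => _ [r [r0 Hr] <-].
rewrite lee_fin leNgt; apply/negP => rs.
have : c%:E <= hausdorff_measure r E.
  apply: (@le_trans _ _ (hausdorff_content r 1 E)); last first.
    by apply: ereal_sup_ubound; exists 1%R => //=.
  apply: le_ereal_inf_tmp => _ [U [EU U1] <-].
  apply: (le_trans (Hc U EU U1)); apply: lee_nneseries => i _.
    by move=> _; exact: hausdorff_weight_ge0.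
  by apply: hausdorff_weight_decr => //; rewrite r0 ltW.
by rewrite Hr lee_fin leNgt c0.
Qed.

(* A cover of E pulls back along g to a cover of [0, 1[. *)
Lemma holder_hausdorff_dim_ge E s C (g : R -> R) : (0 < s)%R -> (0 < C)%R ->
  (forall y, (0 <= y < 1)%R -> E (g y)) ->
  (forall y z, (0 <= y < 1)%R -> (0 <= z < 1)%R ->
     (`|y - z| <= C * `|g y - g z| `^ s)%R) ->
  s%:E <= hausdorff_dim E.
Proof.
move=> s0 C0 gE gC; have C20 : (0 < 2 * C)%R by rewrite mulr_gt0.
apply: (@hausdorff_dim_ge _ _ (2 * C)^-1); first by rewrite invr_gt0.
move=> U EU U1; set mu := @lebesgue_measure R.
(* The preimage of [U i] under [g] need not be measurable. If nonempty, it is enclosed in an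
   interval of radius C diam^s centred at one of its points, whence the constant 2 C. *)
have /choice[F HF] i : exists F : set R, [/\ measurable F,
    (forall y, (0 <= y < 1)%R -> U i (g y) -> F y)
    & mu F <= (2 * C)%:E * hausdorff_weight s (U i)].
  have [[p [p01 Up]]|no] := pselect (exists p, (0 <= p < 1)%R /\ U i (g p)); last first.
    exists set0; split => //.
      by move=> y y01 Uy; apply: no; exists y.
    by rewrite /mu measure0; apply: mule_ge0; [rewrite lee_fin ltW|exact: hausdorff_weight_ge0].
  have [d dE] : exists d, diam (U i) = d%:E.
    have := diam_ge0 (U i); have := U1 i.
    by case: (diam (U i)) => [d| |] //; exists d.
  have d0 : (0 <= d)%R by rewrite -lee_fin -dE diam_ge0.
  set rho := (C * d `^ s)%R.
  have rho0 : (0 <= rho)%R by rewrite mulr_ge0 ?powR_ge0 ?ltW.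
  exists `[(p - rho)%R, (p + rho)%R]%classic; split.
  - exact: measurable_itv.
  - move=> y y01 Uy; rewrite /= in_itv /= -ler_distl.
    apply: (le_trans (gC y p y01 p01)); apply: ler_wpM2l; first exact: ltW.
    apply: ge0_ler_powR; rewrite ?nnegrE //; first exact: ltW.
    by rewrite -lee_fin -dE le_diam.
  - rewrite /hausdorff_weight; case: ifPn => [/eqP U0|_]; first by move: Up; rewrite U0.
    rewrite dE poweR_EFin -EFinM /mu lebesgue_measure_itv /=.
    case: ifPn => _; last by rewrite lee_fin -mulrA mulr_ge0.
    by rewrite -EFinD lee_fin /rho; lra.
have h : mu `[0%R, 1%R[%classic <= \sum_(0 <= i <oo) mu (F i).
  apply: measure_sigma_subadditive.
  - by move=> i; case: (HF i).
  - exact: measurable_itv.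
  - move=> y /=; rewrite in_itv /= => y01.
    by have [i _ Ui] := EU _ (gE _ y01); exists i => //; case: (HF i) => _ + _; apply.
have {}h : 1 <= (2 * C)%:E * \sum_(0 <= i <oo) hausdorff_weight s (U i).
  rewrite -nneseriesZl; last by move=> i _; exact: hausdorff_weight_ge0.
  apply: le_trans (_ : \sum_(0 <= i <oo) mu (F i) <= _); last first.
    by apply: lee_nneseries => // i _; case: (HF i).
  apply: le_trans h; rewrite /mu lebesgue_measure_itv /= lte01 oppr0 adde0; exact: lexx.
by rewrite -[leLHS]mule1 lee_pdivrMl // mule1.
Qed.

End DimensionBounds.

Lemma expr_small (R : realType) (r e : R) : 0 <= r < 1 -> 0 < e ->
  exists N, r ^+ N <= e.
Proof.
move=> /andP[r0 r1] e0.
have /cvgrPdist_le/(_ e e0)[N _ HN] : GRing.exp r n @[n --> \oo] --> (0 : R).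
  by apply: cvg_expr; rewrite ger0_norm.
by exists N; have := HN N (leqnn N); rewrite sub0r normrN ger0_norm ?exprn_ge0.
Qed.

(** * Mass distributions on words of digits *)

Section MassDistribution.
Variables (R : realType) (v : seq nat -> R) (M : seq nat -> nat).
Hypothesis v_nil : v [::] = 1.
Hypothesis v_ge0 : forall w, 0 <= v w.
(** Only an inequality is asked for: the cells of the children cover the cell of [w] and may extend
    beyond it, which does no harm since a child is chosen separately for each point. *)
Hypothesis v_split : forall w, v w <= \sum_(a < M w) v (rcons w a).
Hypothesis v_pos : forall w, 0 < v w -> all (leq 1) w.

(* The masses cut [0, 1[ into nested cells: that of w is
   [cell_start w, cell_start w + v w[. *)
Let cell_start w : R :=
  \sum_(i < size w) \sum_(b < nth 0%N w i) v (rcons (take i w) b).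

Let cell w y := cell_start w <= y < cell_start w + v w.

Let cell_start_rcons w a :
  cell_start (rcons w a) = cell_start w + \sum_(b < a) v (rcons w b).
Proof.
rewrite /cell_start size_rcons big_ord_recr /=; congr (_ + _).
  apply: eq_bigr => i _; rewrite nth_rcons ltn_ord -cats1 takel_cat //.
  exact: ltnW.
by rewrite nth_rcons ltnn eqxx -cats1 take_size_cat.
Qed.

Let cell_next w y : cell w y -> exists a, cell (rcons w a) y.
Proof.
move=> /andP[ly yu].
have : y < cell_start w + \sum_(b < M w) v (rcons w b).
  by apply: lt_le_trans yu _; rewrite lerD2l.
elim: (M w) => [|K IH] yK; first by move: yK; rewrite big_ord0 addr0 ltNge ly.
case: (ltP y (cell_start w + \sum_(b < K) v (rcons w b))) => [/IH//|Ky].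
exists K; rewrite /cell cell_start_rcons Ky /=.
by move: yK; rewrite big_ord_recr /= addrA.
Qed.

Let cell_pos w y : cell w y -> 0 < v w.
Proof. by move=> /andP[ly yu]; rewrite -(ltrD2l (cell_start w)) addr0 (le_lt_trans ly). Qed.

(** Descending through cells that contain [y] produces an infinite sequence of digits, positive
    because these cells have positive mass. *)
Let cell_point (y : R) : 0 <= y < 1 -> exists x : R,
  [/\ 0 <= x < 1, irrational x & forall n, cell (prefix_word n x) y].
Proof.
move=> y01.
have /choice[f Hf] w : exists a, cell w y -> cell (rcons w a) y.
  have [/cell_next[a Ha]|no] := pselect (cell w y); first by exists a.
  by exists 0%N.
pose words n := iter n (fun w => rcons w (f w)) [::].
have cw n : cell (words n) y.
  elim: n => [|n IH]; last exact: Hf.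
  by rewrite /cell /cell_start big_ord0 add0r v_nil.
pose a n := f (words n).
have a0 n : (0 < a n)%N.
  by have /v_pos := cell_pos (cw n.+1); rewrite all_rcons => /andP[].
have wE n : words n = mkseq a n by elim: n => //= n IH; rewrite mkseqS -IH.
have [x [x01 irx xa]] := digit_sequence_realized R a0.
by exists x; split => // n; rewrite (prefix_word_mkseq n xa) -wE.
Qed.

(** Let g send [y] to a point whose digits follow cells containing [y]. Where the digits of g y and
    g z first differ, [y] and [z] lie in adjacent cells whose total length is the sum bounded in the
    separation hypothesis, so the inverse of g is Hölder. If all digits agree, y = z because cells
    of order n have length at most r^n. *)
Lemma mass_hausdorff_dim_ge (E : set R) (s C r : R) : 0 < s -> 0 < C -> 0 <= r < 1 ->
  (forall w, v w <= r ^+ size w) ->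
  (forall x, 0 <= x < 1 -> irrational x ->
     (forall n, 0 < v (prefix_word n x)) -> E x) ->
  (forall n x y, 0 <= x < 1 -> irrational x -> 0 <= y < 1 -> irrational y ->
     (forall k, 0 < v (prefix_word k x)) -> (forall k, 0 < v (prefix_word k y)) ->
     prefix_word n x = prefix_word n y ->
     (partial_quotient n.+1 x < partial_quotient n.+1 y)%N ->
     \sum_(partial_quotient n.+1 x <= b < (partial_quotient n.+1 y).+1)
        v (rcons (prefix_word n x) b) <= C * `|x - y| `^ s) ->
  (s%:E <= hausdorff_dim E)%E.
Proof.
move=> s0 C0 /andP[r0 r1] vr vE sep.
have /choice[g Hg] y : exists x : R, 0 <= y < 1 ->
    [/\ 0 <= x < 1, irrational x & forall n, cell (prefix_word n x) y].
  have [/cell_point[x Hx]|no] := pselect (0 <= y < 1); first by exists x.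
  by exists 0.
apply: (holder_hausdorff_dim_ge (g := g) s0 C0).
  move=> y /Hg[g01 irg cg]; apply: vE => // n; exact: cell_pos (cg n).
have main y z : 0 <= y < 1 -> 0 <= z < 1 -> forall n,
    prefix_word n (g y) = prefix_word n (g z) ->
    (partial_quotient n.+1 (g y) < partial_quotient n.+1 (g z))%N ->
    `|y - z| <= C * `|g y - g z| `^ s.
  move=> y01 z01 n eyz lyz.
  have [gy01 irgy cy] := Hg y y01; have [gz01 irgz cz] := Hg z z01.
  apply: le_trans (sep n _ _ gy01 irgy gz01 irgz _ _ eyz lyz); last first.
    by move=> k; exact: cell_pos (cz k).
    by move=> k; exact: cell_pos (cy k).
  have /andP[y1 y2] := cy n.+1; have /andP[z1 z2] := cz n.+1.
  move: y1 y2 z1 z2; rewrite !prefix_wordS -eyz !cell_start_rcons.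
  move: lyz; set a := partial_quotient _ _; set a' := partial_quotient _ _ => aa'.
  set w := prefix_word n _ => y1 y2 z1 z2.
  pose S (i j : nat) : R := \sum_(i <= b < j) v (rcons w b).
  have SE k : \sum_(b < k) v (rcons w b) = S 0%N k by rewrite /S big_mkord.
  have S1 k : S 0%N k.+1 = S 0%N k + v (rcons w k) by rewrite /S big_nat_recr.
  have S2 : S 0%N a'.+1 = S 0%N a + S a a'.+1.
    by rewrite /S (@big_cat_nat _ _ _ a) //= ltnW // ltnS ltnW.
  have S3 : S 0%N a' = S 0%N a.+1 + S a.+1 a'.
    by rewrite /S (@big_cat_nat _ _ _ a.+1).
  have S4 : 0 <= S a.+1 a' by apply: sumr_ge0.
  have := S1 a; have := S1 a'; rewrite !SE in y1 y2 z1 z2.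
  rewrite -/(S a a'.+1) => S5 S6.
  by rewrite ler_norml; apply/andP; split; lra.
move=> y z y01 z01.
have [gy01 irgy cy] := Hg y y01; have [gz01 irgz cz] := Hg z z01.
have [same|/existsNP[n0 diff]] :=
  pselect (forall n, prefix_word n (g y) = prefix_word n (g z)).
  have yz n : `|y - z| <= r ^+ n.
    have /andP[y1 y2] := cy n; have /andP[z1 z2] := cz n.
    rewrite same in y1 y2; have := vr (prefix_word n (g z)).
    by rewrite size_prefix_word ler_norml => h; apply/andP; split; lra.
  have -> : `|y - z| = 0.
    apply/eqP; rewrite eq_le normr_ge0 andbT; apply/ler_addgt0Pr => e e0.
    have [N rN] : exists N, r ^+ N <= e by apply: expr_small; rewrite ?r0.
    by rewrite add0r (le_trans (yz N)).
  by rewrite mulr_ge0 ?powR_ge0 // ltW.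
have exP : exists n, prefix_word n (g y) != prefix_word n (g z) by exists n0; apply/eqP.
case: (ex_minnP exP) => -[|n]; first by rewrite eqxx.
move=> neq minn.
have eqn : prefix_word n (g y) = prefix_word n (g z).
  by apply/eqP/negPn/negP => /minn; rewrite ltnn.
have : partial_quotient n.+1 (g y) != partial_quotient n.+1 (g z).
  by apply: contraNneq neq => e; rewrite !prefix_wordS eqn e.
rewrite neq_ltn => /orP[lt|lt]; first exact: main lt.
rewrite distrC [in leRHS]distrC; exact: main lt.
Qed.

End MassDistribution.

(** * Digits growing doubly exponentially *)

Section AdmissibleWords.
Variable D : nat -> nat -> bool.

Definition admissible (w : seq nat) : bool :=
  all (fun i => D i (nth 0%N w i)) (iota 0 (size w)).

Lemma admissible_rcons w a : admissible (rcons w a) = admissible w && D (size w) a.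
Proof.
rewrite /admissible size_rcons -(addn1 (size w)) iotaD all_cat /= add0n andbT.
rewrite nth_rcons ltnn eqxx; congr (_ && _).
apply: eq_in_all => i; rewrite mem_iota => /andP[_]; rewrite add0n => iw.
by rewrite nth_rcons iw.
Qed.

Lemma admissible_prefix_word (R : realType) (x : R) :
  (forall n, admissible (prefix_word n x)) -> forall n, D n (partial_quotient n.+1 x).
Proof.
move=> adx n; have := adx n.+1.
by rewrite prefix_wordS admissible_rcons size_prefix_word => /andP[].
Qed.

Lemma admissible_posw w : (forall n a, D n a -> (0 < a)%N) ->
  admissible w -> all (leq 1) w.
Proof.
move=> D0; elim/last_ind: w => // w a IH.
by rewrite admissible_rcons posw_rcons => /andP[/IH -> /D0 ->].
Qed.

End AdmissibleWords.

Section FastDigits.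
Variables (R : realType) (d k : R).
Hypotheses (d_gt1 : 1 < d) (k_ge1 : 1 <= k).

Let L n : nat := (Num.truncn (expR (k * d ^+ n.+1))).+1.

Let D n a := (L n <= a < 2 * L n)%N.

(** Position i allows exactly [L i] digits, so [N n] counts the admissible words of length n, and
    its inverse is the mass of each. *)
Let N n : R := \prod_(i < n) (L i)%:R.

Let v (w : seq nat) : R := if admissible D w then (N (size w))^-1 else 0.

Let L_gt n : expR (k * d ^+ n.+1) < (L n)%:R.
Proof. by have /andP[] := truncn_itv (expR_ge0 (k * d ^+ n.+1)). Qed.

Let expn_d n : 1 <= d ^+ n.
Proof. by apply: exprn_ege1; exact: ltW. Qed.

Let k_gt0 : 0 < k.
Proof. exact: lt_le_trans ltr01 k_ge1. Qed.

Let k_le n : k <= k * d ^+ n.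
Proof. by rewrite ler_peMr ?expn_d // ltW. Qed.

Let L_le n : (L n)%:R <= 2 * expR (k * d ^+ n.+1).
Proof.
have /andP[h _] := truncn_itv (expR_ge0 (k * d ^+ n.+1)).
have : 1 <= expR (k * d ^+ n.+1).
  by rewrite -(expR0 R) ler_expR (le_trans _ (k_le n.+1)) // ltW.
by rewrite /L -natr1; lra.
Qed.

Let L_ge2 n : (2 <= L n)%N.
Proof.
rewrite -(ltr_nat R) (le_lt_trans _ (L_gt n)) // -(expR0 R) ler_expR (le_trans _ (k_le n.+1)) //; exact: ltW.
Qed.

Let L_gt0 n : 0 < (L n)%:R :> R.
Proof. by rewrite ltr0n (leq_trans _ (L_ge2 n)). Qed.

Let N_gt0 n : 0 < N n. Proof. exact: prodr_gt0. Qed.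

Let NS n : N n.+1 = N n * (L n)%:R. Proof. by rewrite /N big_ord_recr. Qed.

Let D_gt0 n a : D n a -> (0 < a)%N.
Proof. by move=> /andP[+ _]; apply: leq_trans; exact: leq_trans (L_ge2 n). Qed.

Let v_rcons w a : admissible D w ->
  v (rcons w a) = if D (size w) a then (N (size w) * (L (size w))%:R)^-1 else 0.
Proof. by move=> aw; rewrite /v admissible_rcons aw /= size_rcons NS. Qed.

Let v_split w : v w <= \sum_(a < 2 * L (size w)) v (rcons w a).
Proof.
have v0 u : 0 <= v u by rewrite /v; case: ifP => // _; rewrite invr_ge0 ltW.
rewrite {1}/v; case: ifP => aw; last exact: sumr_ge0.
set n := size w.
rewrite -(big_mkord xpredT (fun a => v (rcons w a))).
rewrite (@big_cat_nat _ _ _ (L n)) //=; last by rewrite mul2n -addnn leq_addr.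
apply: ler_wpDl; first exact: sumr_ge0.
rewrite (eq_big_nat _ _ (F2 := fun=> (N n * (L n)%:R)^-1)); last first.
  by move=> a aL; rewrite v_rcons // /D -/n aL.
rewrite sumr_const_nat mul2n -addnn addnK -[leRHS]mulr_natr invfM -mulrA mulVf ?mulr1 //.
by rewrite lt0r_neq0.
Qed.

Let prod_le w : admissible D w -> \prod_(a <- w) a.+1%:R <= 2 ^+ size w * N (size w).
Proof.
elim/last_ind: w => [|w a IH]; first by rewrite big_nil /N big_ord0 mulr1.
rewrite admissible_rcons => /andP[/IH {}IH /andP[_ aL]].
rewrite -cats1 big_cat big_seq1 /= cats1 size_rcons NS exprS.
have aL' : a.+1%:R <= 2 * (L (size w))%:R :> R by rewrite -natrM ler_nat.
apply: le_trans (ler_pM _ _ IH aL') _; rewrite ?prodr_ge0 //.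
by rewrite le_eqVlt; apply/orP; left; apply/eqP; ring.
Qed.

Let N_lower n : expR (k * \sum_(i < n) d ^+ i.+1) <= N n.
Proof.
rewrite /N mulr_sumr expR_sum; apply: ler_prod => i _.
by rewrite expR_ge0 ltW.
Qed.

Let sum_expn n : (d - 1) * (\sum_(i < n) d ^+ i.+1) + d = d ^+ n.+1.
Proof.
elim: n => [|n IH]; first by rewrite big_ord0 mulr0 add0r expr1.
by rewrite big_ord_recr /= [RHS]exprS -IH; ring.
Qed.

(** Summing the geometric series gives ln (L n) <= (d - 1) ln (N n) + ln 2 + k d. Hence the
    logarithm of the left side is at most s (1 + d) ln (N n) + s n ln 4 up to a constant, and since
    ln (N n) >= k n the surplus (1 - s (1 + d)) ln (N n) absorbs s n ln 4. *)
Let key (s : R) n : 0 < s -> s * ln 4 <= (1 - s * (1 + d)) * k ->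
  (4 ^+ n * N n ^+ 2 * (L n)%:R) `^ s <= expR (s * (ln 2 + k * d)) * N n.
Proof.
move=> s0 ks; set S := \sum_(i < n) d ^+ i.+1.
have NE : N n = expR (ln (N n)) by rewrite lnK ?posrE //; exact: N_gt0.
have lN : k * S <= ln (N n) by rewrite -ler_expR -NE; exact: N_lower.
have Sn : n%:R <= S.
  rewrite -[n in n%:R](card_ord n) -sumr_const; apply: ler_sum => i _; exact: expn_d.
have E4 : (4 : R) ^+ n = expR (n%:R * ln 4) by rewrite expRM_natl lnK ?posrE.
have LE : (L n)%:R <= expR (ln 2 + ((d - 1) * (k * S) + k * d)).
  rewrite expRD lnK ?posrE // (_ : _ + k * d = k * d ^+ n.+1) ?L_le //.
  by rewrite -sum_expn -/S; ring.
apply: (@le_trans _ _ (expR (n%:R * ln 4 + 2 * ln (N n) +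
    (ln 2 + ((d - 1) * (k * S) + k * d))) `^ s)).
  apply: ge0_ler_powR; rewrite ?nnegrE ?expR_ge0 ?(ltW s0) //.
    by rewrite !mulr_ge0 ?exprn_ge0 // ltW.
  rewrite expRD; apply: ler_pM => //; first by rewrite mulr_ge0 ?exprn_ge0 // ltW.
  by rewrite expRD E4 [expR (2 * _)]expRM_natl -NE.
rewrite -expRM [in leRHS]NE -expRD ler_expR.
have d1 : (d - 1) * (k * S) <= (d - 1) * ln (N n) by apply: ler_wpM2l; rewrite // subr_ge0 ltW.
have n1 : n%:R * (s * ln 4) <= n%:R * ((1 - s * (1 + d)) * k) by apply: ler_wpM2l.
have ln4 : 0 <= ln (4 : R) by apply: ln_ge0; lra.
have e0 : 0 <= (1 - s * (1 + d)) * k by apply: le_trans ks; rewrite mulr_ge0 // ltW.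
have e1 : 0 <= 1 - s * (1 + d) by rewrite -(pmulr_lge0 _ k_gt0).
have n2 : n%:R * ((1 - s * (1 + d)) * k) <= (1 - s * (1 + d)) * ln (N n).
  rewrite mulrCA; apply: ler_wpM2l => //; apply: le_trans lN.
  by rewrite mulrC ler_wpM2l // ltW.
have sd : s * ((d - 1) * (k * S)) <= s * ((d - 1) * ln (N n)) by apply: ler_wpM2l => //; exact: ltW.
lra.
Qed.

(** If two points first differ at digit n + 1, by m, their distance is at least t / (32 Q) with t =
    m / L n and Q = 4^n N_n^2 L_n, while the cells involved have mass at most 2 t / N n. As t <= 1
    gives t <= t^s, the estimate [key] for Q^s yields the Hölder bound. *)
Lemma fast_digits_dim (E : set R) (s : R) : 0 < s -> s * (1 + d) < 1 ->
  s * ln 4 <= (1 - s * (1 + d)) * k ->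
  (forall x, 0 <= x < 1 -> irrational x ->
     (forall n, expR (k * d ^+ n.+1) <= (partial_quotient n.+1 x)%:R) -> E x) ->
  (s%:E <= hausdorff_dim E)%E.
Proof.
move=> s0 sd ks HE.
have admP (x : R) n : 0 < v (prefix_word n x) -> admissible D (prefix_word n x).
  by rewrite /v; case: ifP => //; rewrite ltxx.
have C0 : 0 < 2 * 32 `^ s * expR (s * (ln 2 + k * d)).
  by rewrite !mulr_gt0 ?powR_gt0 ?expR_gt0.
apply: (@mass_hausdorff_dim_ge _ v (fun w => 2 * L (size w))%N _ _ _ _ E s _ 2^-1 s0 C0).
- by rewrite /v /= /N big_ord0 invr1.
- by move=> w; rewrite /v; case: ifP => // _; rewrite invr_ge0 ltW.
- exact: v_split.
- move=> w; rewrite /v; case: ifP; last by rewrite ltxx.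
  by move=> aw _; apply: admissible_posw aw => n a; exact: D_gt0.
- by rewrite invr_ge0 ler0n invf_lt1 // ltr1n.
- move=> w; rewrite /v; case: ifP => _; last by rewrite exprn_ge0 // invr_ge0.
  rewrite exprVn lef_pV2 ?posrE ?exprn_gt0 //.
  elim: (size w) => [|n IH]; first by rewrite /N big_ord0.
  rewrite exprS mulrC NS; apply: ler_pM => //; rewrite ?exprn_ge0 //.
  by rewrite ler_nat.
- move=> x x01 irx vx; apply: HE => // n.
  have /andP[Ln _] : D n (partial_quotient n.+1 x).
    by apply: admissible_prefix_word => m; exact: admP.
  by apply: le_trans (ltW (L_gt n)) _; rewrite ler_nat.
- move=> n x y x01 irx y01 iry vx vy exy.
  have adx := admissible_prefix_word (fun n => admP x n (vx n)).
  have ady := admissible_prefix_word (fun n => admP y n (vy n)).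
  have gap := prefix_gap x01 irx y01 iry (esym exy).
  move: gap (adx n) (ady n) (adx n.+1).
  rewrite [iter n.+1 _ x](iter_gaussE n.+1 x01 irx).
  have [/andP[u0 _] _] := iter_gauss n.+2 x01 irx.
  have [/andP[z0 _] _] := iter_gauss n.+1 y01 iry.
  move: u0 z0; set w := prefix_word n x; set u := iter n.+2 _ x; set z := iter _ _ y.
  set a := partial_quotient n.+1 x; set a' := partial_quotient n.+1 y.
  set a2 := partial_quotient n.+2 x => u0 z0 gap /andP[_ aL] /andP[_ a'L] /andP[a2L _] aa'.
  have aw : admissible D w by exact: admP.
  have sw : size w = n by exact: size_prefix_word.
  have Q0 : 0 < 4 ^+ n * N n ^+ 2 * (L n)%:R by rewrite !mulr_gt0 ?exprn_gt0.
  have [m mE m1] : exists2 m : R, a'%:R = a%:R + m & 1 <= m.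
    exists (a' - a)%:R; last by rewrite ler1n subn_gt0.
    by rewrite natrB 1?ltnW // addrC subrK.
  have mL : m <= (L n)%:R.
    have : a'%:R <= 2 * (L n)%:R :> R by rewrite -natrM ler_nat ltnW.
    have : (L n)%:R <= a%:R :> R.
      by move: (adx n) => /andP[+ _]; rewrite ler_nat.
    lra.
  have gap2 : m / (L n)%:R / (32 * (4 ^+ n * N n ^+ 2 * (L n)%:R)) <= `|x - y|.
    apply: le_trans (gap aa').
    have a22 : 2 <= a2%:R :> R by rewrite ler_nat (leq_trans (L_ge2 n.+1)).
    (* The next digit of [x] is at least 2, so the complete quotients differ by at least m - 1/2 >=
       m / 2, even when m = 1. *)
    have iv : (a2%:R + u)^-1 <= 2^-1 by rewrite lef_pV2 ?posrE //; lra.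
    have q0 : 0 < den R w.
      by have [] := den_bounds R (posw_prefix_word n x01 irx) => *; lra.
    have qle : den R w <= 2 ^+ n * N n.
      have /andP[_ h] := den_prod R (posw_prefix_word n x01 irx).
      by apply: le_trans h _; rewrite -{2 3}sw; exact: prod_le.
    apply: (@le_trans _ _ (m / 2 / (4 * (2 ^+ n * N n) ^+ 2 * (2 * (L n)%:R) * (2 * (L n)%:R)))).
      rewrite le_eqVlt; apply/orP; left; apply/eqP.
      have -> : (4 : R) ^+ n = 2 ^+ n * 2 ^+ n by rewrite -exprMn; congr (_ ^+ _); lra.
      by field; rewrite !lt0r_neq0 ?exprn_gt0.
    apply: ler_pM.
    - by rewrite mulr_ge0 //; lra.
    - by rewrite invr_ge0 !mulr_ge0 ?sqr_ge0 ?ltW.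
    - lra.
    rewrite lef_pV2 ?posrE ?mulr_gt0 ?exprn_gt0 ?mulr_gt0 ?exprn_gt0 //.
    apply: ler_pM => //; first by rewrite !mulr_ge0 ?sqr_ge0 ?(ltW q0).
      apply: ler_pM => //; first by rewrite !mulr_ge0 ?sqr_ge0 ?(ltW q0).
        rewrite ler_pM2l //; apply: lerXn2r => //; rewrite nnegrE; first exact: ltW.
        by rewrite mulr_ge0 ?exprn_ge0 // ltW.
      by rewrite -natrM ler_nat.
    by rewrite -natrM ler_nat.
  have sumle : \sum_(a <= b < a'.+1) v (rcons w b) <= 2 * (m / (L n)%:R) / N n.
    apply: (@le_trans _ _ (\sum_(a <= b < a'.+1) (N n * (L n)%:R)^-1)).
      apply: ler_sum => b _; rewrite v_rcons // sw; case: ifP => // _.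
      by rewrite invr_ge0 mulr_ge0 ?ltW.
    rewrite sumr_const_nat -[leLHS]mulr_natr subSn; last exact: ltnW.
    have -> : (a' - a).+1%:R = m + 1 by rewrite -natr1 natrB ?(ltnW aa') // mE; ring.
    rewrite invfM.
    rewrite [leRHS](_ : _ = (L n)%:R^-1 * (N n)^-1 * (2 * m)); last by ring.
    rewrite [leLHS](_ : _ = (L n)%:R^-1 * (N n)^-1 * (m + 1)); last by ring.
    by apply: ler_wpM2l; [rewrite mulr_ge0 // invr_ge0 ltW|lra].
  apply: (le_trans sumle).
  set t := m / _ in gap2 sumle *; set Q := 4 ^+ n * _ * _ in gap2 Q0.
  have t0 : 0 < t by rewrite divr_gt0 //; lra.
  have t1 : t <= 1 by rewrite ler_pdivrMr ?mul1r.
  have s1 : s <= 1 by have := d_gt1; nra.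
  have ts : t <= t `^ s by apply: ger1_powR => //; rewrite t0.
  have Q32 : 0 <= 32 * Q by rewrite mulr_ge0 // ltW.
  have tQ : 0 <= t / (32 * Q) by rewrite divr_ge0 // ltW.
  have tE : t `^ s = 32 `^ s * Q `^ s * (t / (32 * Q)) `^ s.
    rewrite -powRM ?(ltW Q0) // -powRM //.
    by congr (_ `^ _); field; rewrite lt0r_neq0.
  have Qs : Q `^ s <= expR (s * (ln 2 + k * d)) * N n by exact: key.
  have gs : (t / (32 * Q)) `^ s <= `|x - y| `^ s.
    apply: ge0_ler_powR; rewrite ?nnegrE ?(ltW s0) //.
  rewrite ler_pdivrMr // -mulrA.
  rewrite -!mulrA ler_pM2l //; apply: (le_trans ts); rewrite tE -mulrA.
  rewrite ler_pM2l ?powR_gt0 //.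
  rewrite [leRHS](_ : _ = expR (s * (ln 2 + k * d)) * N n * `|x - y| `^ s); last by ring.
  by apply: ler_pM; rewrite ?powR_ge0.
Qed.

End FastDigits.

(** * Prescribing sparse digits *)

Section SparseDigitEstimates.
Variable R : realType.

(** The summands are the lengths of the cylinders obtained by appending the digit i; each is at most
    q^-2, and there are at most M of them. *)
Lemma cylinder_sum_le (q q' : R) (a a' M : nat) : 1 <= q -> 0 <= q' ->
  (0 < a)%N -> (a' <= M)%N ->
  \sum_(a <= i < a'.+1) ((i%:R * q + q') * (i%:R * q + q' + q))^-1 <= M%:R / q ^+ 2.
Proof.
move=> q1 q'0 a0 a'M; have q0 : 0 < q by lra.
apply: (@le_trans _ _ (\sum_(a <= i < a'.+1) (q ^+ 2)^-1)).
  rewrite big_nat_cond [leRHS]big_nat_cond; apply: ler_sum => i /andP[/andP[ai _] _].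
  have i1 : 1 <= i%:R :> R by rewrite ler1n (leq_trans _ ai).
  have iq : q <= i%:R * q + q' by nra.
  rewrite lef_pV2 ?posrE ?exprn_gt0 ?mulr_gt0 //; [|lra..].
  by rewrite expr2; apply: ler_pM; lra.
rewrite sumr_const_nat -[leLHS]mulr_natl ler_wpM2r ?invr_ge0 ?sqr_ge0 //.
by rewrite ler_nat leq_subLR -add1n leq_add.
Qed.

(** Since a + u <= a', the numerator is at least 1 / (b + z), and the bound on the next digit b
    makes this at least 1 / ((M + 1) e). *)
Lemma sparse_gap_le (q e u z : R) (a a' b M : nat) :
  0 < q -> 0 < e -> 0 <= u <= 1 -> 0 <= z <= 1 -> (0 < b)%N ->
  (a < a')%N -> (a' <= M)%N -> b%:R + 1 <= (M%:R + 1) * e ->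
  (4 * (M%:R + 1) ^+ 3)^-1 / (e * q ^+ 2) <=
  (a'%:R + (b%:R + z)^-1 - (a%:R + u)) / (4 * q ^+ 2 * a.+1%:R * a'.+1%:R).
Proof.
move=> q0 e0 /andP[u0 u1] /andP[z0 z1] b0 aa' a'M bM.
have m0 : 0 <= M%:R :> R by [].
have B1 : 1 <= b%:R :> R by rewrite ler1n.
have aa1 : 1 + a%:R <= a'%:R :> R by rewrite -(natrD _ 1) ler_nat.
have a1R : 0 < a.+1%:R :> R by rewrite ltr0n.
have a1R' : 0 < a'.+1%:R :> R by rewrite ltr0n.
have Ma : a.+1%:R <= M%:R + 1 :> R by rewrite natr1 ler_nat (leq_trans aa') // leqW.
have Ma' : a'.+1%:R <= M%:R + 1 :> R by rewrite natr1 ler_nat.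
move: M%:R m0 a.+1%:R a'.+1%:R a%:R a'%:R b%:R bM B1 aa1 a1R a1R' Ma Ma'.
move=> m m0 x x' y y' w wm w1 yy x0 x'0 xm x'm.
have m1 : 0 < m + 1 by lra.
have z3 : ((m + 1) * e)^-1 <= (w + z)^-1.
  by rewrite lef_pV2 ?posrE ?mulr_gt0 //; lra.
have q20 : 0 < 4 * q ^+ 2 by rewrite mulr_gt0 ?exprn_gt0.
apply: (@le_trans _ _ (((m + 1) * e)^-1 / (4 * q ^+ 2 * (m + 1) * (m + 1)))).
  rewrite le_eqVlt; apply/orP; left; apply/eqP.
  by field; rewrite !lt0r_neq0.
apply: ler_pM; [ | |lra| ].
- by rewrite invr_ge0 mulr_ge0 // ltW.
- by rewrite invr_ge0 ltW // mulr_gt0 // mulr_gt0.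
rewrite lef_pV2 ?posrE; first last.
  by rewrite !mulr_gt0.
  by rewrite !mulr_gt0.
apply: ler_pM => //; first by rewrite mulr_ge0 ?(ltW q20) ?(ltW x0).
  exact: ltW.
by apply: ler_pM => //; exact: ltW.
Qed.

(* With eta = (1 - s) ln 2 / 2, the gain [2 ^ (n (1 - s))] pays for the two
   factors [expR (eta * n)]. *)
Lemma sparse_holder_bound (s K c t W y : R) n (eta := (1 - s) * ln 2 / 2) :
  0 < s -> s < 1 -> 0 < K -> 0 < c -> 0 < t -> 2 ^+ n <= 2 * t ->
  0 < W -> W <= expR (eta * n%:R) -> c / (expR (eta * n.+2%:R) * t) <= y ->
  K * W / t <= K * 2 `^ (1 - s) * expR (2 * eta) / c `^ s * y `^ s.
Proof.
move=> s0 s1 K0 c0 t0 n2t W0 We cy; set e := expR (eta * n.+2%:R) in cy.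
have eta0 : 0 <= eta.
  have : 0 < ln (2 : R) by apply: ln_gt0; rewrite ltr1n.
  by move=> l; rewrite /eta divr_ge0 // mulr_ge0 ?(ltW l) // subr_ge0 ltW.
have e0 : 0 < e by exact: expR_gt0.
have et0 : 0 < e * t by rewrite mulr_gt0.
have gs : (c / (e * t)) `^ s <= y `^ s.
  apply: ge0_ler_powR; rewrite ?nnegrE ?(ltW s0) //.
    by rewrite divr_ge0 // ltW.
  by apply: le_trans cy; rewrite divr_ge0 // ltW.
have yE : (c / (e * t)) `^ s = c `^ s / (e `^ s * t `^ s).
  have cE : c `^ s = (c / (e * t)) `^ s * (e * t) `^ s.
    by rewrite -powRM ?divr_ge0 ?(ltW c0) ?(ltW et0) // divfK // lt0r_neq0.
  by rewrite -powRM ?(ltW e0) ?(ltW t0) // cE mulfK // lt0r_neq0 // powR_gt0.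
have main : W * e `^ s <= expR (2 * eta) * (2 `^ (1 - s) * t `^ (1 - s)).
  have : (2 ^+ n) `^ (1 - s) <= (2 * t) `^ (1 - s).
    apply: ge0_ler_powR; rewrite ?nnegrE ?exprn_ge0 ?subr_ge0 ?(ltW s1) //.
    by rewrite mulr_ge0 // ltW.
  rewrite powRM ?(ltW t0) // => h.
  have h2 : expR (2 * eta) * expR (2 * eta * n%:R) <=
      expR (2 * eta) * (2 `^ (1 - s) * t `^ (1 - s)).
    rewrite ler_pM2l ?expR_gt0 //; apply: le_trans h.
    rewrite -powR_mulrn // powRAC -powRrM /powR gt_eqF //.
    by rewrite ler_expR /eta; lra.
  apply: le_trans h2; rewrite -expRM -expRD.
  apply: (@le_trans _ _ (expR (eta * n%:R) * expR (eta * n.+2%:R * s))).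
    by rewrite ler_pM2r ?expR_gt0.
  rewrite -expRD ler_expR -[n.+2%:R]natr1 -[n.+1%:R]natr1.
  have en : 0 <= eta * (n%:R + 1 + 1) by rewrite mulr_ge0 // !addr_ge0.
  have : eta * (n%:R + 1 + 1) * s <= eta * (n%:R + 1 + 1) by rewrite ler_piMr // ltW.
  lra.
have tE : t = t `^ (1 - s) * t `^ s.
  by rewrite -powRD ?subrK ?powRr1 ?(ltW t0) //; apply/implyP; rewrite lt0r_neq0.
apply: (@le_trans _ _ (K * 2 `^ (1 - s) * expR (2 * eta) / c `^ s *
   (c / (e * t)) `^ s)); last first.
  by apply: ler_wpM2l gs; rewrite !mulr_ge0 ?invr_ge0 ?powR_ge0 ?expR_ge0 // ltW.
rewrite yE [X in _ / X <= _]tE.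
have := powR_gt0 s e0; have := powR_gt0 s t0; have := powR_gt0 s c0.
have := powR_gt0 (1 - s) t0; move: main.
move: (t `^ s) (t `^ (1 - s)) (e `^ s) (c `^ s) (2 `^ (1 - s)) (expR (2 * eta)).
move=> x1 x2 x3 x4 x5 x6 main p1 p2 p3 p4 {yE gs tE cy We n2t}.
rewrite [leRHS](_ : _ = K * (x6 * (x5 * x2) / (x2 * x1 * x3))); last first.
  by field; rewrite !lt0r_neq0.
rewrite -[leLHS]mulrA ler_pM2l // ler_pdivlMr ?mulr_gt0 //.
apply: le_trans main; rewrite le_eqVlt; apply/orP; left; apply/eqP.
by field; rewrite !lt0r_neq0.
Qed.

End SparseDigitEstimates.

Section SparseDigits.
Variables (R : realType) (A : nat -> nat) (s : R).
Hypotheses (s_gt0 : 0 < s) (s_lt1 : s < 1).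
Hypothesis A_gt0 : forall n, (0 < A n)%N.
Hypothesis A_small : forall e : R, 0 < e -> forall N, exists2 n, (N <= n)%N &
  (A n)%:R + 2 <= expR (e * n.+1%:R).

Let eta : R := (1 - s) * ln 2 / 2.
(** Free digits range over 1, ..., M. This keeps at least the fraction M / (M + 2) of the length of
    a cylinder, which the factor [rho] restores; M is so large that [rho] is at most exp(eta /
    2). *)
Let M : nat := (Num.truncn (4 / eta)).+1.
Let rho : R := (M%:R + 2) / M%:R.
(** Prescribing the digit [A n] keeps at least the fraction 1 / [cost n] of the length of a
    cylinder. *)
Let cost n : R := ((A n)%:R + 1) * ((A n)%:R + 2).

(* The digit at position n.+1 is prescribed to be A n as soon as the
   accumulated loss of mass W stays below expR (eta * n.+1). *)
Let Fixpoint W n : R :=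
  if n is m.+1 then
    (if rho * W m * cost m <= expR (eta * m.+1%:R) then rho * W m * cost m
     else rho * W m)
  else 1.

Let sp n : bool := rho * W n * cost n <= expR (eta * n.+1%:R).

Let WS n : W n.+1 = if sp n then rho * W n * cost n else rho * W n.
Proof. by []. Qed.

Let D n a : bool := if sp n then a == A n else (1 <= a <= M)%N.

Let v (w : seq nat) : R :=
  if admissible D w then W (size w) / (den R w * (den R w + den' R w)) else 0.

Let ln2_gt0 : 0 < ln 2 :> R.
Proof. by apply: ln_gt0; rewrite ltr1n. Qed.

Let eta_gt0 : 0 < eta.
Proof. by rewrite /eta divr_gt0 // mulr_gt0 // subr_gt0. Qed.

Let M_gt0 : 0 < M%:R :> R.
Proof. by rewrite ltr0n. Qed.

Let rhoE : rho = 1 + 2 / M%:R.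
Proof. by rewrite /rho mulrDl divff // lt0r_neq0. Qed.

Let rho_ge1 : 1 <= rho.
Proof. by rewrite rhoE lerDl divr_ge0. Qed.

Let rho_le : rho <= expR (eta / 2).
Proof.
apply: le_trans (expR_ge1Dx _); rewrite rhoE lerD2l ler_pdivrMr //.
have /andP[_ h] : (Num.truncn (4 / eta))%:R <= 4 / eta < M%:R.
  by apply: truncn_itv; rewrite divr_ge0 // ltW.
move: h; rewrite ltr_pdivrMr // => h; lra.
Qed.

Let cost_ge1 n : 1 <= cost n.
Proof.
have a1 : 1 <= (A n)%:R :> R by rewrite ler1n.
rewrite /cost; nra.
Qed.

Let W_bounds n : 1 <= W n <= expR (eta * n%:R).
Proof.
elim: n => [|n /andP[W1 We]]; first by rewrite /= mulr0 expR0 lexx.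
rewrite WS; have := rho_ge1; have := cost_ge1 n => c1 r1.
have rW : 1 <= rho * W n by nra.
case: ifPn => [spn|_]; apply/andP; split => //; first by nra.
rewrite -natr1 mulrDr mulr1 expRD mulrC; apply: ler_pM => //; [lra|lra|].
by apply: (le_trans rho_le); rewrite ler_expR; have := eta_gt0; lra.
Qed.

Let W_gt0 n : 0 < W n.
Proof. by have /andP[h _] := W_bounds n; exact: lt_le_trans ltr01 h. Qed.

(** Without prescribed positions after N, [W] grows at rate at most eta / 2. At some n >= 4 N the
    cost is at most exp(eta (n + 1) / 4), and the product then passes the test defining [sp]. *)
Let sp_infinite N : exists2 n, (N <= n)%N & sp n.
Proof.
apply: contrapT => no.
have nsp n : (N <= n)%N -> sp n = false.
  by move=> Nn; apply/negbTE/negP => spn; apply: no; exists n.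
have WE j : W (N + j)%N <= expR (eta / 2 * j%:R) * W N.
  elim: j => [|j IH]; first by rewrite addn0 mulr0 expR0 mul1r.
  rewrite addnS WS nsp ?leq_addr // -[j.+1%:R]natr1 mulrDr mulr1 addrC expRD -mulrA.
  by apply: ler_pM => //; [exact: le_trans rho_ge1|exact: ltW].
have e0 : 0 < eta / 8 by rewrite divr_gt0.
have [n Nn An] := A_small e0 (4 * N)%N.
have Nn' : (N <= n)%N by apply: leq_trans Nn; rewrite leq_pmull.
suff : sp n by rewrite nsp.
have /andP[_ WN] := W_bounds N.
have Wn : rho * W n <= expR (eta / 2) * (expR (eta / 2 * (n - N)%:R) * expR (eta * N%:R)).
  apply: ler_pM => //; [exact: le_trans rho_ge1|exact: ltW|].
  have := WE (n - N)%N; rewrite subnKC // => h; apply: (le_trans h).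
  by rewrite ler_pM2l ?expR_gt0.
have cn : cost n <= expR (eta / 8 * n.+1%:R) * expR (eta / 8 * n.+1%:R).
  rewrite /cost; have a1 : 1 <= (A n)%:R :> R by rewrite ler1n.
  by apply: ler_pM => //; lra.
rewrite /sp; apply: le_trans (ler_pM _ _ Wn cn) _.
- by rewrite mulr_ge0 ?(ltW (W_gt0 _)) // (le_trans ler01 rho_ge1).
- exact: le_trans (cost_ge1 n).
rewrite -!expRD ler_expR natrB // -[n.+1%:R]natr1.
have N4 : 4 * N%:R <= n%:R :> R by rewrite -natrM ler_nat.
have : eta * (4 * N%:R) <= eta * n%:R by rewrite ler_pM2l.
have : 0 <= eta by exact: ltW.
have : 0 <= eta * n%:R by rewrite mulr_ge0 // ltW.
lra.
Qed.

Let D_gt0 n a : D n a -> (0 < a)%N.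
Proof. by rewrite /D; case: ifP => _; [move=> /eqP ->|move=> /andP[]]. Qed.

(** Each summand is 1 / q times the difference of the values of 1 / (a q + q') at a and a + 1. *)
Let cyl_telescope (q q' : R) K : 1 <= q -> 0 <= q' ->
  \sum_(1 <= a < K.+1) ((a%:R * q + q') * (a%:R * q + q' + q))^-1 =
  K%:R / ((q + q') * (K.+1%:R * q + q')).
Proof.
move=> q1 q'0; elim: K => [|K IH]; first by rewrite big_geq // mul0r.
rewrite big_nat_recr //= IH -!natr1.
have K0 : 0 <= K%:R * q by rewrite mulr_ge0 //; lra.
field; rewrite !lt0r_neq0 //=; lra.
Qed.

Let v_rcons w a : admissible D w -> v (rcons w a) =
  if D (size w) a then W (size w).+1 /
    ((a%:R * den R w + den' R w) * (a%:R * den R w + den' R w + den R w)) else 0.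
Proof.
by move=> aw; rewrite /v admissible_rcons aw /= size_rcons den_rcons den'_rcons.
Qed.

Let admissible_pos w : admissible D w -> all (leq 1) w.
Proof. by apply: admissible_posw => n a; exact: D_gt0. Qed.

Let v_ge0 w : 0 <= v w.
Proof.
rewrite /v; case: ifP => // /admissible_pos/(den_bounds R)[q1 q'0 _].
by rewrite divr_ge0 ?(ltW (W_gt0 _)) // mulr_ge0 //; lra.
Qed.

(** At a prescribed position the single admissible child is compensated by [cost]; at a free one the
    lengths of the children 1, ..., M telescope, and [rho] makes up for the missing digits. *)
Let v_split w : v w <= \sum_(a < (maxn M (A (size w))).+1) v (rcons w a).
Proof.
rewrite {1}/v; case: ifP => aw; last by apply: sumr_ge0.
have [q1 q'0 q'q] := den_bounds R (admissible_pos aw).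
have sum_ge0 (P : pred 'I_(maxn M (A (size w))).+1) :
    0 <= \sum_(a < (maxn M (A (size w))).+1 | P a) v (rcons w a).
  exact: sumr_ge0.
have W0 := W_gt0 (size w).
have r1 := rho_ge1.
case: (boolP (sp (size w))) => spw.
  have Ai : (A (size w) < (maxn M (A (size w))).+1)%N by rewrite ltnS leq_maxr.
  rewrite (bigD1 (Ordinal Ai)) //=; apply: ler_wpDr => //.
  rewrite v_rcons // /D WS spw eqxx /cost.
  have a1 : 1 <= (A (size w))%:R :> R by rewrite ler1n.
  move: (A _)%:R a1 (den R w) (den' R w) q1 q'0 q'q (W _) W0 => a a1 q q' q1 q'0 q'q x x0.
  have n1 : 0 < a * q + q' by nra.
  have n2 : 0 < (a * q + q') * (a * q + q' + q) by rewrite mulr_gt0 //; lra.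
  have n3 : 0 < q * (q + q') by rewrite mulr_gt0 //; lra.
  rewrite ler_pdivrMr // mulrAC ler_pdivlMr //.
  have h1 : (a * q + q') * (a * q + q' + q) <= ((a + 1) * q) * ((a + 2) * (q + q')).
    by apply: ler_pM; nra.
  have h2 : x * ((a * q + q') * (a * q + q' + q)) <=
      x * (((a + 1) * q) * ((a + 2) * (q + q'))) by rewrite ler_pM2l.
  apply: (le_trans h2).
  have h3 : 0 <= x * (((a + 1) * q) * ((a + 2) * (q + q'))).
    by rewrite !mulr_ge0 //; lra.
  have : x * (((a + 1) * q) * ((a + 2) * (q + q'))) <=
         rho * (x * (((a + 1) * q) * ((a + 2) * (q + q')))).
    by rewrite ler_peMl.
  lra.
rewrite -(big_mkord xpredT (fun a => v (rcons w a))).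
rewrite (@big_cat_nat _ _ _ M.+1) //=; last by rewrite ltnS leq_maxl.
apply: ler_wpDr; first exact: sumr_ge0.
rewrite big_ltn //; apply: ler_wpDl => //.
rewrite (eq_big_nat _ _ (F2 := fun a => rho * W (size w) *
    ((a%:R * den R w + den' R w) * (a%:R * den R w + den' R w + den R w))^-1)); last first.
  by move=> a aM; rewrite v_rcons // /D WS (negbTE spw) aM.
rewrite -mulr_sumr cyl_telescope //.
rewrite -[leLHS]mulr1 mulrC [leRHS]mulrC.
move: (den R w) (den' R w) q1 q'0 q'q (W _) W0 => q q' q1 q'0 q'q x x0.
rewrite /rho -natr1; have m0 := M_gt0; move: M%:R m0 => m m0.
have t : 0 < (m + 1) * q + q' by nra.
rewrite [leRHS](_ : _ = x * ((m + 2) / ((q + q') * ((m + 1) * q + q')))); last first.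
  by field; rewrite !lt0r_neq0 //; lra.
have n1 : 0 < q * (q + q') by rewrite mulr_gt0 //; lra.
have n2 : 0 < (q + q') * ((m + 1) * q + q') by rewrite mulr_gt0 //; lra.
rewrite mul1r ler_pM2l // ler_pdivlMr // mulrC ler_pdivrMr //.
rewrite (_ : (m + 2) * (q * (q + q')) = (q + q') * ((m + 2) * q)); last by ring.
by rewrite ler_pM2l; lra.
Qed.

Lemma sparse_digits_dim (E : set R) :
  (forall x, 0 <= x < 1 -> irrational x ->
     (forall N, exists2 n, (N <= n)%N & partial_quotient n.+1 x = A n) -> E x) ->
  (s%:E <= hausdorff_dim E)%E.
Proof.
move=> HE; have eta0 := eta_gt0; have r1 := rho_ge1; have l2 := ln2_gt0.
have M1 : 1 <= M%:R :> R by rewrite ler1n.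
have admP (x : R) n : 0 < v (prefix_word n x) -> admissible D (prefix_word n x).
  by rewrite /v; case: ifP => //; rewrite ltxx.
set c : R := (4 * (M%:R + 1) ^+ 3)^-1.
have c0 : 0 < c by rewrite invr_gt0 mulr_gt0 // exprn_gt0 //; lra.
have C0 : 0 < (M%:R + 2) * 2 `^ (1 - s) * expR (2 * eta) / c `^ s.
  by rewrite divr_gt0 ?powR_gt0 // !mulr_gt0 ?powR_gt0 ?expR_gt0 //; lra.
have r01 : 0 <= expR eta / 2 < 1.
  rewrite divr_ge0 ?expR_ge0 //= ltr_pdivrMr // mul1r -[ltRHS]lnK ?posrE // ltr_expR.
  by rewrite /eta; have := s_gt0; have := s_lt1; nra.
apply: (@mass_hausdorff_dim_ge _ v (fun w => (maxn M (A (size w))).+1) _ _ _ _ E s _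
  _ s_gt0 C0 r01).
- by rewrite /v /= den_nil den'_nil addr0 !mul1r invr1.
- exact: v_ge0.
- exact: v_split.
- move=> w; rewrite /v; case: ifP; last by rewrite ltxx.
  by move=> aw _; exact: admissible_pos.
- move=> w; rewrite /v; case: ifP => aw; last first.
    by rewrite exprn_ge0 // divr_ge0 // expR_ge0.
  have /andP[_ We] := W_bounds (size w).
  have := expn2_den R (admissible_pos aw) => h.
  rewrite expr_div_n -expRM_natr; apply: ler_pM => //; first exact: ltW.
    by rewrite invr_ge0 (le_trans _ h) // exprn_ge0.
  by rewrite lef_pV2 ?posrE ?exprn_gt0 // (lt_le_trans _ h) // exprn_gt0.
- move=> x x01 irx vx; apply: HE => // N.
  have [n Nn spn] := sp_infinite N; exists n => //.
  have := admissible_prefix_word (fun n => admP x n (vx n)) n.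
  by rewrite /D spn => /eqP.
- move=> n x y x01 irx y01 iry vx vy exy.
  have adx := admissible_prefix_word (fun n => admP x n (vx n)).
  have ady := admissible_prefix_word (fun n => admP y n (vy n)).
  have gap := prefix_gap x01 irx y01 iry (esym exy).
  move: gap (adx n) (ady n) (ady n.+1).
  rewrite [iter n.+1 _ y](iter_gaussE n.+1 y01 iry).
  have [/andP[u0 u1] _] := iter_gauss n.+1 x01 irx.
  have [/andP[z0 z1] _] := iter_gauss n.+2 y01 iry.
  have pw := posw_prefix_word n x01 irx.
  have [q1 q'0 q'q] := den_bounds R pw.
  have q2 := expn2_den R pw.
  have sw := size_prefix_word n x; rewrite sw in q2.
  have aw : admissible D (prefix_word n x) by exact: admP.
  have b1 : (0 < partial_quotient n.+2 y)%N by exact: partial_quotient_gt0.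
  move: aw pw sw q1 q'0 q'q q2 u0 u1 z0 z1 b1; set w := prefix_word n x.
  set u := iter n.+1 _ x; set z := iter _ _ y.
  set a := partial_quotient n.+1 x; set a' := partial_quotient n.+1 y.
  set b := partial_quotient n.+2 y => aw pw sw q1 q'0 q'q q2 u0 u1 z0 z1 b1.
  move=> gap Da Da' Db aa'.
  (* At a prescribed position both digits would equal [A n], so the first difference occurs at a
     free position. *)
  have nsp : sp n = false.
    apply/negP => spn; move: Da Da'; rewrite /D spn => /eqP Ea /eqP Ea'.
    by move: aa'; rewrite Ea Ea' ltnn.
  have /andP[_ aM] : (1 <= a <= M)%N by move: Da; rewrite /D nsp.
  have /andP[_ a'M] : (1 <= a' <= M)%N by move: Da'; rewrite /D nsp.
  set q := den R w in q1 q'q q2 gap *; set q' := den' R w in q'0 q'q q2.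
  set e := expR (eta * n.+2%:R).
  have e1 : 1 <= e by rewrite -(expR0 R) ler_expR mulr_ge0 // ltW.
  (* The next digit of [y] may be a prescribed, large one. Passing the test [sp] at n + 1 then
     bounds its cost by [e], which is why [e] involves n + 2. *)
  have bM : b%:R + 1 <= (M%:R + 1) * e.
    move: Db; rewrite /D; case: ifP => [spb /eqP bA|_ /andP[_ bM]]; last first.
      have bM' : b%:R + 1 <= M%:R + 1 :> R by rewrite lerD2r ler_nat.
      by apply: (le_trans bM'); rewrite ler_peMr //; lra.
    have /andP[W1 _] := W_bounds n.+1.
    have A1 : 1 <= b%:R :> R by rewrite ler1n.
    move: spb; rewrite /sp -/e /cost -bA => h.
    apply: (@le_trans _ _ e); last by rewrite ler_peMl //; lra.
    apply: le_trans h; apply: (@le_trans _ _ ((b%:R + 1) * (b%:R + 2))).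
      by rewrite ler_peMr //; lra.
    have rW : 1 <= rho * W n.+1 by exact: mulr_ege1.
    by rewrite ler_peMl // mulr_ge0 //; lra.
  have q0 : 0 < q by exact: lt_le_trans ltr01 q1.
  have e0 : 0 < e by exact: lt_le_trans ltr01 e1.
  have gap2 : c / (e * q ^+ 2) <= `|x - y|.
    apply: le_trans (gap aa').
    by apply: sparse_gap_le; rewrite ?u0 ?z0 ?(ltW u1) ?(ltW z1).
  have sumle : \sum_(a <= i < a'.+1) v (rcons w i) <= (M%:R + 2) * W n / q ^+ 2.
    have rW : 0 <= rho * W n.
      by rewrite mulr_ge0 ?(ltW (W_gt0 n)) // (le_trans ler01 r1).
    apply: (@le_trans _ _ (\sum_(a <= i < a'.+1)
        rho * W n * ((i%:R * q + q') * (i%:R * q + q' + q))^-1)).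
      apply: ler_sum => i _; rewrite v_rcons // sw WS nsp; case: ifP => // _.
      have iq : 0 <= i%:R * q + q' by rewrite addr_ge0 // mulr_ge0 // ltW.
      by rewrite mulr_ge0 // invr_ge0 mulr_ge0 // addr_ge0 // ltW.
    rewrite -mulr_sumr.
    apply: le_trans (ler_wpM2l rW (cylinder_sum_le q1 q'0 (D_gt0 Da) a'M)) _.
    rewrite le_eqVlt; apply/orP; left; apply/eqP.
    rewrite /rho; move: M%:R M_gt0 => mr m0.
    by field; rewrite !lt0r_neq0.
  apply: (le_trans sumle).
  apply: sparse_holder_bound gap2 => //.
  - by rewrite exprn_gt0.
  - apply: (le_trans q2); rewrite mulrDr mulr_natl mulr2n expr2 lerD2l.
    by rewrite ler_pM2l.
  - by have /andP[] := W_bounds n.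
Qed.

End SparseDigits.

(** * Covers by cylinders with a large digit *)

Section SumsOverWords.
Variable R : realType.

Lemma powR_prod_seq (w : seq nat) (r : R) :
  (\prod_(a <- w) a%:R) `^ r = \prod_(a <- w) (a%:R `^ r).
Proof.
elim: w => [|a w IH]; first by rewrite !big_nil powR1.
by rewrite !big_cons powRM ?prodr_ge0 // IH.
Qed.

(* Telescoping, from K^-sigma >= (K+1)^-sigma (1 + sigma / (K+1)). *)
Lemma zeta_partial_sum_le (tau : R) K : 1 < tau ->
  \sum_(1 <= a < K.+1) a%:R `^ (- tau) <= 1 + (tau - 1)^-1.
Proof.
move=> tau1; set sigma := tau - 1.
have s0 : 0 < sigma by rewrite subr_gt0.
have -> : tau = 1 + sigma by rewrite /sigma addrC subrK.
case: K => [|K]; first by rewrite big_geq // addr_ge0 // invr_ge0 ltW.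
apply: (@le_trans _ _ (1 + sigma^-1 - K.+1%:R `^ (- sigma) / sigma)); last first.
  by rewrite gerBl divr_ge0 ?powR_ge0 // ltW.
elim: K => [|K IH].
  by rewrite big_nat1 !powR1 mul1r addrK.
rewrite big_nat_recr //=; apply: le_trans (lerD IH (lexx _)) _.
set x : R := K.+1%:R; have xE : K.+2%:R = x + 1 by rewrite /x natr1.
have x1 : 1 <= x by rewrite ler1n.
rewrite xE; have y0 : 0 < x + 1 by lra.
have -> : (x + 1) `^ (- (1 + sigma)) = (x + 1) `^ (- sigma) / (x + 1).
  rewrite (_ : - (1 + sigma) = - sigma - 1); last by ring.
  rewrite powRD; last by rewrite (lt0r_neq0 y0) implybT.
  by rewrite powR_inv1 // ltW.
suff h : (x + 1) `^ (- sigma) * (1 + sigma / (x + 1)) <= x `^ (- sigma).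
  rewrite -[leLHS]addrA lerD2l -(ler_pM2r s0) mulrDl mulNr mulfVK ?lt0r_neq0 //.
  rewrite mulNr mulfVK ?lt0r_neq0 //.
  have -> : (x + 1) `^ (- sigma) / (x + 1) * sigma =
    (x + 1) `^ (- sigma) * (1 + sigma / (x + 1)) - (x + 1) `^ (- sigma).
    by field; rewrite lt0r_neq0.
  lra.
have x0 : 0 < x by lra.
have lnx : ln x <= ln (x + 1) - (x + 1)^-1.
  have -> : x = (x + 1) * (1 + - (x + 1)^-1) by field; rewrite lt0r_neq0.
  have i1 : (x + 1)^-1 < 1 by rewrite invf_lt1 //; lra.
  rewrite lnM ?posrE //; last by lra.
  by rewrite [in leRHS](_ : (x + 1) * _ = x) ?lerD2l ?le_ln1Dx //; [lra|field; rewrite lt0r_neq0].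
apply: (@le_trans _ _ (expR (- sigma * ln (x + 1) + sigma / (x + 1)))).
  rewrite expRD /powR gt_eqF // ler_pM2l ?expR_gt0 //.
  exact: expR_ge1Dx.
rewrite /powR gt_eqF // ler_expR.
have : sigma * ln x <= sigma * (ln (x + 1) - (x + 1)^-1) by rewrite ler_pM2l.
lra.
Qed.

Fixpoint bounded_words (n K : nat) : seq (seq nat) :=
  if n is m.+1 then [seq a :: w | a <- iota 1 K, w <- bounded_words m K] else [:: [::]].

Lemma sum_bounded_words (g : nat -> R) n K :
  \sum_(w <- bounded_words n K) \prod_(a <- w) g a = (\sum_(1 <= a < K.+1) g a) ^+ n.
Proof.
elim: n => [|n IH]; first by rewrite /= big_seq1 big_nil.
rewrite /= big_allpairs_dep exprS -IH mulr_suml /index_iota subn1.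
apply: eq_bigr => a _; rewrite mulr_sumr; apply: eq_bigr => w _.
by rewrite big_cons.
Qed.

Lemma mem_bounded_words w K : all (leq 1) w -> all (geq K) w ->
  w \in bounded_words (size w) K.
Proof.
elim: w => //= a w IH /andP[a1 pw] /andP[aK wK].
by apply: allpairs_f; [rewrite mem_iota a1 add1n ltnS|exact: IH].
Qed.

Lemma size_bounded_words n K w : w \in bounded_words n K -> size w = n.
Proof. by elim: n w => [|n IH] w; [rewrite inE => /eqP ->|move=> /allpairsP[[a u] [_ /IH <- ->]]]. Qed.

Lemma ler_sum_sub_seq (T : eqType) (f : T -> R) (F L : seq T) :
  (forall x, 0 <= f x) -> uniq F -> {subset F <= L} ->
  \sum_(x <- F) f x <= \sum_(x <- L) f x.
Proof.
move=> f0; elim: F L => [|x F IH] L; first by rewrite big_nil sumr_ge0.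
move=> /= /andP[xF uF] FL; have xL : x \in L by rewrite FL ?mem_head.
rewrite big_cons (big_rem _ xL) /= lerD2l; apply: IH => // y yF.
by apply: rem_mem; [apply: contraNneq xF => <-|rewrite FL // in_cons yF orbT].
Qed.

(* The factor (2 Z)^-(n+1) beats the zeta sums Z^n over the words of length n. *)
Lemma sum_words_le (tau : R) N (F : seq (seq nat)) (Z := 1 + (tau - 1)^-1) :
  1 < tau -> uniq F -> all (fun w => all (leq 1) w && (N <= size w)%N) F ->
  \sum_(w <- F) (2 * Z) ^- (size w).+1 * \prod_(a <- w) a%:R `^ (- tau) <= 2^-1 ^+ N.
Proof.
move=> tau1 uF aF; pose f (w : seq nat) : R :=
  (2 * Z) ^- (size w).+1 * \prod_(a <- w) a%:R `^ (- tau).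
have Z1 : 1 <= Z by rewrite lerDl invr_ge0; lra.
have f0 w : 0 <= f w.
  rewrite /f mulr_ge0 ?invr_ge0 ?exprn_ge0 ?prodr_ge0 //; lra.
(* One K bounds both the lengths and the digits in the finite family F, so F lies in the list L of
   all words of lengths N, ..., N + K with digits at most K. *)
pose K := (\max_(w <- F) (size w + \max_(a <- w) a))%N.
pose L := flatten [seq bounded_words (N + n) K | n <- iota 0 K.+1].
have FL : {subset F <= L}.
  move=> w wF; have /allP/(_ w wF)/andP[pw Nw] := aF.
  have wK : (size w + \max_(a <- w) a <= K)%N.
    by rewrite /K (@leq_bigmax_seq _ F xpredT (fun w => size w + \max_(a <- w) a)%N).
  apply/flattenP; exists (bounded_words (size w) K); last first.
    rewrite mem_bounded_words //; apply/allP => a aw /=; apply: leq_trans wK.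
    by apply: leq_trans (leq_addl _ _); rewrite (@leq_bigmax_seq _ w xpredT (fun a => a)).
  apply/mapP; exists (size w - N)%N; last by rewrite subnKC.
  rewrite mem_iota add0n ltnS (leq_trans (leq_subr _ _)) // (leq_trans _ wK) //.
  exact: leq_addr.
apply: le_trans (ler_sum_sub_seq f0 uF FL) _.
rewrite big_flatten big_map /=.
apply: (@le_trans _ _ (\sum_(n <- iota 0 K.+1) 2^-1 ^+ (N + n).+1)).
  apply: ler_sum => n _.
  rewrite (eq_big_seq (fun w => (2 * Z) ^- (N + n).+1 * \prod_(a <- w) a%:R `^ (- tau))); last first.
    by move=> w /size_bounded_words wE; rewrite /f wE.
  rewrite -mulr_sumr sum_bounded_words exprMn invfM -exprVn -mulrA.
  rewrite ler_piMr ?exprn_ge0 ?invr_ge0 // mulrC ler_pdivrMr ?exprn_gt0 //; last lra.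
  rewrite mul1r exprS; apply: (@le_trans _ _ (Z ^+ (N + n))); last first.
    by rewrite ler_peMl // exprn_ge0 //; lra.
  apply: lerXn2r; rewrite ?nnegrE; last exact: zeta_partial_sum_le.
    by apply: sumr_ge0 => a _; exact: powR_ge0.
  lra.
suff -> : \sum_(n <- iota 0 K.+1) 2^-1 ^+ (N + n).+1 = 2^-1 ^+ N - 2^-1 ^+ (N + K.+1) :> R.
  by rewrite gerBl exprn_ge0 // invr_ge0.
move: K.+1 => J; have -> : iota 0 J = index_iota 0 J by rewrite /index_iota subn0.
elim: J => [|J IH]; first by rewrite big_geq // addn0 subrr.
by rewrite big_nat_recr //= IH addnS exprS; lra.
Qed.

End SumsOverWords.

(** * Upper bounds for the dimension from covers *)

Section CoverBounds.
Variable R : realType.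
Implicit Types (E : set R) (s : R).
Local Open Scope ereal_scope.

Lemma hausdorff_content_ge0 s d E : 0 <= hausdorff_content s d E.
Proof.
apply: le_ereal_inf_tmp => _ [U _ <-].
by apply: nneseries_ge0 => i _ _; exact: hausdorff_weight_ge0.
Qed.

Lemma hausdorff_dim_le E s : (0 <= s)%R ->
  (forall d e, (0 < d)%R -> (0 < e)%R -> exists U : (set R)^nat,
    [/\ E `<=` \bigcup_i U i, forall i, diam (U i) <= d%:E
      & \sum_(0 <= i <oo) hausdorff_weight s (U i) <= e%:E]) ->
  hausdorff_dim E <= s%:E.
Proof.
move=> s0 cov; apply: ereal_inf_lbound; exists s => //; split => //.
apply/eqP; rewrite eq_le; apply/andP; split; last first.
  apply: le_ereal_sup_tmp; exists (hausdorff_content s 1 E).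
    by exists 1%R => /=.
  exact: hausdorff_content_ge0.
apply: ge_ereal_sup => _ [d /= d0 <-]; apply/lee_addgt0Pr => e e0.
rewrite add0e; have [U [EU Ud Ue]] := cov d e d0 e0.
by apply: ereal_inf_le; exists (\sum_(0 <= i <oo) hausdorff_weight s (U i)) => //; exists U.
Qed.

Lemma nneseries_le_partial (u : (\bar R)^nat) (c : \bar R) : (forall i, 0 <= u i) ->
  (forall n, \sum_(0 <= i < n) u i <= c) -> \sum_(0 <= i <oo) u i <= c.
Proof.
move=> u0 uc; apply: lime_le; first by apply: is_cvg_nneseries => n _ _.
exact: nearW.
Qed.

Lemma hausdorff_dim_unit_interval E : (forall x, E x -> (0 <= x < 1)%R) ->
  hausdorff_dim E <= 1.
Proof.
move=> E01; apply/lee_addgt0Pr => r r0; rewrite -EFinD.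
apply: hausdorff_dim_le; first by rewrite addr_ge0 // ltW.
move=> d e d0 e0.
have [n [n0 nd ne]] : exists n : nat, [/\ (0 < n)%N, (n%:R^-1 <= d)%R
    & (n%:R * n%:R^-1 `^ (1 + r) <= e)%R].
  (* The interval is covered by n intervals of length 1 / n, of total weight n^-r in dimension 1 +
     r. The first term of the maximum makes them short enough, the second makes n^-r at most e. *)
  pose y : R := (Num.max d^-1 (e `^ (- r^-1)))%R.
  pose n := (Num.truncn y).+1; exists n.
  have ny : (y < n%:R)%R.
    have y0 : (0 <= y)%R by rewrite le_max invr_ge0 (ltW d0).
    by have /andP[_ h] := truncn_itv y0; exact: h.
  have n0 : (0 < n%:R :> R)%R by rewrite ltr0n.
  split => //.
    rewrite -[leRHS]invrK lef_pV2 ?posrE ?invr_gt0 // ltW //.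
    by apply: le_lt_trans ny; rewrite le_max lexx.
  rewrite powRD ?powRr1 ?invr_ge0 //; last by rewrite invr_eq0 (lt0r_neq0 n0) implybT.
  rewrite mulrA mulfV ?mul1r ?lt0r_neq0 //.
  have ey : (e `^ (- r^-1) <= n%:R)%R.
    by rewrite ltW // (le_lt_trans _ ny) // le_max lexx orbT.
  have : ((e `^ (- r^-1)) `^ r <= n%:R `^ r)%R.
    by apply: ge0_ler_powR; rewrite ?nnegrE ?powR_ge0 // ltW.
  rewrite -powRrM mulNr mulVf ?lt0r_neq0 // powR_inv1 ?(ltW e0) // => h.
  rewrite -(powR_inv1 (ltW n0)) -powRrM mulN1r powRN.
  by rewrite -[leRHS]invrK lef_pV2 ?posrE ?invr_gt0 ?powR_gt0.
have n0R : (0 < n%:R :> R)%R by rewrite ltr0n.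
pose U i : set R := if (i < n)%N then `[(i%:R / n%:R)%R, (i.+1%:R / n%:R)%R]%classic else set0.
have Ud i : diam (U i) <= (n%:R^-1)%:E.
  apply: diam_le; first by rewrite invr_ge0.
  rewrite /U; case: ifP => // _ x y /=; rewrite !in_itv /= -natr1 mulrDl mul1r.
  by move=> /andP[x1 x2] /andP[y1 y2]; rewrite ler_norml; apply/andP; split; lra.
exists U; split.
- move=> x /E01/andP[x0 x1].
  have xn0 : (0 <= x * n%:R)%R by rewrite mulr_ge0 // ltW.
  have /andP[t1 t2] := truncn_itv xn0.
  exists (Num.truncn (x * n%:R)) => //=; rewrite /U ifT.
    by rewrite /= in_itv /= ler_pdivrMr // t1 ler_pdivlMr // ltW.
  by rewrite -(ltr_nat R) (le_lt_trans t1) // gtr_pMl.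
- by move=> i; apply: le_trans (Ud i) _; rewrite lee_fin.
- apply: nneseries_le_partial; first by move=> i; exact: hausdorff_weight_ge0.
  move=> K; apply: (@le_trans _ _ (\sum_(0 <= i < K | (i < n)%N) (n%:R^-1 `^ (1 + r))%:E)).
    rewrite [leRHS]big_mkcond; apply: lee_sum => i _; case: ifPn => iN.
      by apply: hausdorff_weight_le; rewrite ?invr_ge0 ?addr_ge0 // ltW.
    by rewrite /U (negbTE iN) /hausdorff_weight eqxx.
  rewrite sumEFin lee_fin; apply: le_trans ne.
  have cn : (count (fun i => i < n)%N (index_iota 0 K) <= n)%N.
    rewrite -size_filter -[leqRHS](size_iota 0 n); apply: uniq_leq_size.
      by rewrite filter_uniq // iota_uniq.
    by move=> i; rewrite mem_filter mem_iota => /andP[].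
  rewrite big_const_seq iter_addr_0 -[leLHS]mulr_natl ler_wpM2r ?powR_ge0 //.
  by rewrite ler_nat.
Qed.

End CoverBounds.

Section LargeDigits.
Variable R : realType.

Definition large_digit_cylinder (A theta : R) (w : seq nat) : set R :=
  [set x | [/\ 0 <= x < 1, irrational x, prefix_word (size w) x = w &
    A ^+ (size w).+1 * (\prod_(a <- w) a%:R) `^ theta <=
      (partial_quotient (size w).+1 x)%:R]].

(** With H the lower bound on the next digit, the Gauss iterates of these points lie in [0, 1 / H],
    and [mobius w] contracts distances by at least P^2 because [den w] is at least the product P of
    the digits. *)
Lemma diam_large_digit_cylinder (A theta : R) w : 0 < A -> all (leq 1) w ->
  (diam (large_digit_cylinder A theta w) <=
    ((A ^+ (size w).+1 * (\prod_(a <- w) a%:R) `^ (2 + theta))^-1)%:E)%E.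
Proof.
move=> A0 pw; set P : R := \prod_(a <- w) a%:R; set H := A ^+ (size w).+1 * P `^ theta.
have P0 : 0 < P.
  rewrite /P big_seq; apply: prodr_gt0 => a aw.
  by rewrite ltr0n; have /allP := pw; apply.
have H0 : 0 < H by rewrite mulr_gt0 ?exprn_gt0 ?powR_gt0.
have -> : A ^+ (size w).+1 * P `^ (2 + theta) = H * P ^+ 2.
  rewrite powRD; last by rewrite (lt0r_neq0 P0) implybT.
  by rewrite powR_mulrn ?(ltW P0) // /H; ring.
apply: diam_le; first by rewrite invr_ge0 mulr_ge0 ?exprn_ge0 // ltW.
have tail_itv x : large_digit_cylinder A theta w x ->
    x = mobius w (iter (size w) (@gauss_map R) x) /\
    0 <= iter (size w) (@gauss_map R) x <= H^-1.
  move=> [x01 irx xw Hx]; split.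
    by rewrite -[in X in mobius X _]xw; exact: mobius_prefix_word.
  have [/andP[u0 _] _] := iter_gauss (size w) x01 irx.
  have [/andP[v0 _] _] := iter_gauss (size w).+1 x01 irx.
  rewrite u0 iter_gaussE //= lef_pV2 ?posrE //.
    by apply: (le_trans Hx); rewrite lerDl.
  by rewrite (lt_le_trans H0) // (le_trans Hx) // lerDl.
move=> x y /tail_itv[xE /andP[u0 u1]] /tail_itv[yE /andP[v0 v1]].
rewrite [X in `|X - _|]xE [X in `|_ - X|]yE.
move: (iter _ _ x) (iter _ _ y) u0 u1 v0 v1 {xE yE} => u v u0 u1 v0 v1.
have [q1 q'0 _] := den_bounds R pw.
have /andP[Pq _] := den_prod R pw.
rewrite mobius_dist // [leRHS]invfM; apply: ler_pM => //.
- by rewrite invr_ge0 mulr_ge0 // addr_ge0 ?mulr_ge0 //; lra.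
- by rewrite ler_norml; apply/andP; split; lra.
have Pu z : 0 <= z -> P <= den R w + z * den' R w.
  by move=> z0; rewrite (le_trans Pq) // lerDl mulr_ge0.
have Pu0 z : 0 <= z -> 0 < den R w + z * den' R w.
  by move=> /Pu; exact: lt_le_trans.
rewrite lef_pV2 ?posrE ?exprn_gt0 ?mulr_gt0 ?Pu0 // expr2.
by apply: ler_pM; rewrite ?(ltW P0) // Pu.
Qed.

Lemma large_digits_dim_le (E : set R) (s theta : R) : 0 < s -> 0 <= theta ->
  1 < s * (2 + theta) ->
  (forall x, E x -> [/\ 0 <= x < 1, irrational x & forall A : R, 1 <= A ->
    forall N, exists2 n, (N <= n)%N &
      A ^+ n.+1 * (\prod_(a <- prefix_word n x) a%:R) `^ theta <=
        (partial_quotient n.+1 x)%:R]) ->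
  (hausdorff_dim E <= s%:E)%E.
Proof.
move=> s0 th0 st HE; set tau := s * (2 + theta) in st.
set Z := 1 + (tau - 1)^-1.
have Z1 : 1 <= Z by rewrite lerDl invr_ge0; lra.
(* A >= 2 makes the diameters at most 2^-N; A^s >= 2 Z lets [sum_words_le] bound the sum of their
   s-th powers. *)
pose A := Num.max 2 ((2 * Z) `^ s^-1).
have A2 : 2 <= A by rewrite le_max lexx.
have A0 : 0 < A by lra.
have As : 2 * Z <= A `^ s.
  have {1}-> : 2 * Z = ((2 * Z) `^ s^-1) `^ s.
    by rewrite -powRrM mulVf ?lt0r_neq0 // powRr1 //; lra.
  apply: ge0_ler_powR; rewrite ?nnegrE ?powR_ge0 ?(ltW s0) ?(ltW A0) //.
  by rewrite le_max lexx orbT.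
apply: hausdorff_dim_le; first exact: ltW.
move=> d e d0 e0.
have [N HN] : exists N, 2^-1 ^+ N <= Num.min d e.
  apply: expr_small; last by rewrite lt_min d0.
  by rewrite invr_ge0 ler0n invf_lt1 // ltr1n.
have [Nd Ne] : 2^-1 ^+ N <= d /\ 2^-1 ^+ N <= e.
  by move: HN; rewrite le_min => /andP[].
pose ok (w : seq nat) := all (leq 1) w && (N <= size w)%N.
pose f (w : seq nat) : R := (2 * Z) ^- (size w).+1 * \prod_(a <- w) a%:R `^ (- tau).
(* The cover is indexed by the codes of words; an index that codes no positive word of length at
   least N receives the empty set. *)
pose U i : set R := if pickle_inv i is Some w then
  (if ok w then large_digit_cylinder A theta w else set0) else set0.
have P1 (w : seq nat) : all (leq 1) w -> 1 <= \prod_(a <- w) a%:R :> R.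
  move=> pw; rewrite big_seq; apply: (big_ind (fun x : R => 1 <= x)) => //.
    by move=> x y; exact: mulr_ege1.
  by move=> a aw; rewrite ler1n; have /allP := pw; apply.
have f0 w : 0 <= f w.
  by rewrite /f mulr_ge0 ?invr_ge0 ?exprn_ge0 ?prodr_ge0 //; lra.
exists U; split.
- move=> x /HE[x01 irx /(_ A _ N)[|n Nn xn]]; first by lra.
  exists (pickle (prefix_word n x)) => //; rewrite /U pickleK_inv /ok.
  rewrite posw_prefix_word // size_prefix_word Nn /=.
  by split => //; rewrite size_prefix_word.
- move=> i; rewrite /U; case: (pickle_inv i) => [w|]; last first.
    by apply: diam_le => //; exact: ltW.
  case: ifP => [/andP[pw Nw]|_]; last by apply: diam_le => //; exact: ltW.
  apply: le_trans (diam_large_digit_cylinder _ A0 pw) _; rewrite lee_fin.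
  apply: le_trans Nd; rewrite exprVn lef_pV2 ?posrE ?mulr_gt0 ?exprn_gt0 ?powR_gt0 //; last first.
    exact: lt_le_trans (P1 w pw).
  apply: (@le_trans _ _ (A ^+ (size w).+1)).
    apply: (@le_trans _ _ (2 ^+ (size w).+1)).
      by apply: ler_weXn2l => //; [lra|exact: leqW].
    by apply: lerXn2r; rewrite ?nnegrE //; lra.
  rewrite ler_peMr ?exprn_ge0 ?(ltW A0) //.
  apply: (@le_trans _ _ ((\prod_(a <- w) a%:R) `^ 0)); first by rewrite powRr0.
  by apply: ler_powR; [exact: P1|lra].
have wU i : (hausdorff_weight s (U i) <=
    (oapp (fun w => if ok w then f w else 0) 0 (pickle_inv i))%:E)%E.
  rewrite /U; case: (pickle_inv i) => [w|] /=; last by rewrite /hausdorff_weight eqxx.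
  case: ifP => [/andP[pw Nw]|_]; last by rewrite /hausdorff_weight eqxx.
  have Pp : 0 < \prod_(a <- w) a%:R :> R by exact: lt_le_trans (P1 w pw).
  have X0 : 0 <= A ^+ (size w).+1 * (\prod_(a <- w) a%:R) `^ (2 + theta).
    by rewrite mulr_ge0 ?powR_ge0 // exprn_ge0 // ltW.
  apply: le_trans (hausdorff_weight_le (ltW s0) _ (diam_large_digit_cylinder _ A0 pw)) _.
    by rewrite invr_ge0.
  rewrite lee_fin -(powR_inv1 X0) powRAC powR_inv1 ?powR_ge0 //.
  rewrite powRM ?powR_ge0 ?exprn_ge0 ?(ltW A0) // invfM /f.
  rewrite -powRrM [_ * s]mulrC -/tau -[X in _ * X]powRN powR_prod_seq.
  apply: ler_pM => //; first by rewrite invr_ge0 powR_ge0.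
    by rewrite prodr_ge0.
  rewrite -powR_mulrn ?(ltW A0) // powRAC powR_mulrn ?powR_ge0 //.
  rewrite lef_pV2 ?posrE ?exprn_gt0 ?powR_gt0 //; last lra.
  by apply: lerXn2r; rewrite ?nnegrE ?powR_ge0 //; lra.
apply: nneseries_le_partial; first by move=> i; exact: hausdorff_weight_ge0.
move=> K; apply: (@le_trans _ _ (\sum_(0 <= i < K)
    (oapp (fun w => if ok w then f w else 0) 0 (pickle_inv i))%:E)%E).
  by apply: lee_sum => i _; exact: wU.
rewrite sumEFin lee_fin -big_pmap -big_mkcond -big_filter; apply: le_trans Ne.
apply: sum_words_le => //; last by apply: filter_all.
by rewrite filter_uniq // (pmap_uniq (@pickle_invK _)) // iota_uniq.
Qed.

End LargeDigits.

(** * Digits of points of the limsup set *)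

Section LowerLimits.
Variable R : realType.
Implicit Types (u : (\bar R)^nat) (P : nat -> Prop).

Lemma limn_einf_ereal_sup u : limn_einf u = ereal_sup (range (einfs u)).
Proof. by rewrite limn_einf_lim; apply/cvg_lim => //; exact: cvg_einfs_sup. Qed.

Lemma lt_limn_einf u c : (c < limn_einf u)%E ->
  exists N, forall n, (N <= n)%N -> (c < u n)%E.
Proof.
rewrite limn_einf_ereal_sup => /ereal_sup_gt[_ [N _ <-] cN]; exists N => n Nn.
by apply: (lt_le_trans cN); apply: ereal_inf_lbound; exists n.
Qed.

Lemma limn_einf_lt u c : (limn_einf u < c)%E ->
  forall N, exists2 n, (N <= n)%N & (u n < c)%E.
Proof.
move=> uc N; have : (einfs u N < c)%E.
  by apply: le_lt_trans uc; rewrite limn_einf_ereal_sup; apply: ereal_sup_ubound; exists N.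
by move=> /ereal_inf_lt[_ [n /= Nn <-] nc]; exists n.
Qed.

Lemma infinite_setP_nat P :
  infinite_set [set n | P n] <-> forall N, exists2 n, (N <= n)%N & P n.
Proof.
split=> [infP N|often finP].
  apply: contrapT => no; apply: infP; apply: (sub_finite_set _ (finite_II N)) => n /= Pn.
  by rewrite ltnNge; apply/negP => Nn; apply: no; exists n.
have /finite_seqP[s sP] := finP.
have [n ns Pn] := often (\max_(i <- s) i).+1.
have : n \in s by have : [set` s] n by rewrite -sP.
by move=> /(@leq_bigmax_seq _ s xpredT id n)/(_ isT); rewrite leqNgt ns.
Qed.

End LowerLimits.

Section Digits.
Variables (R : realType) (m : nat) (t : 'I_m -> R) (Psi : nat -> R).
Hypothesis t_gt0 : forall i, 0 < t i.
Hypothesis Psi_ge1 : forall n, (1 <= n)%N -> 1 <= Psi n.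

(** The other factors are at least 1, so one large digit makes the whole product large. *)
Lemma le_window_prod (x : R) (i : 'I_m) n : 0 <= x < 1 -> irrational x -> (1 <= n)%N ->
  (partial_quotient (n + i) x)%:R `^ t i <=
    \prod_(j < m) (partial_quotient (n + j) x)%:R `^ t j.
Proof.
move=> x01 irx n1; rewrite (bigD1 i) //= ler_peMr ?powR_ge0 //.
apply: (big_ind (fun y : R => 1 <= y)) => //; first by move=> a b; exact: mulr_ege1.
move=> j _; rewrite -[leLHS](powRr0 (partial_quotient (n + j) x)%:R).
apply: ler_powR; last exact: ltW.
by rewrite ler1n partial_quotient_gt0 // addn_gt0 n1.
Qed.

(* If from some point on every digit stayed below A^(n+1) P_n^theta, where P_n
   is the product of the first n digits, then [theta * ln P_n + n * ln A] would
   be O(n (1 + theta)^n), and so would the logarithms of the digits. *)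
Lemma limsup_product_set_large_digits (theta : R) : 0 <= theta ->
  (forall C : R, exists N, forall n, (N <= n)%N ->
     C * n%:R * (1 + theta) ^+ n < ln (Psi n)) ->
  forall x, limsup_product_set t Psi x ->
  [/\ 0 <= x < 1, irrational x & forall A : R, 1 <= A ->
    forall N, exists2 n, (N <= n)%N &
      A ^+ n.+1 * (\prod_(a <- prefix_word n x) a%:R) `^ theta <=
        (partial_quotient n.+1 x)%:R].
Proof.
move=> th0 growth x [x01 irx infx]; split => // A A1 N.
apply: contrapT => no.
pose a n : R := (partial_quotient n.+1 x)%:R.
have a_ge1 n : 1 <= a n by rewrite /a ler1n partial_quotient_gt0.
pose P n : R := \prod_(b <- prefix_word n x) b%:R.
have PS n : P n.+1 = P n * a n by rewrite /P prefix_wordS -cats1 big_cat big_seq1.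
have P_ge1 n : 1 <= P n.
  by elim: n => [|n IH]; [rewrite /P big_nil|rewrite PS mulr_ege1].
set al := ln A; have al0 : 0 <= al by exact: ln_ge0.
set g := 1 + theta; have g1 : 1 <= g by rewrite lerDl.
(* The failing inequality becomes ln (a n) <= u n + al, hence the linear recursion [uS] of ratio g =
   1 + theta. *)
pose u n : R := theta * ln (P n) + n%:R * al.
have digit n : (N <= n)%N -> ln (a n) <= u n + al.
  move=> Nn; have : a n <= A ^+ n.+1 * P n `^ theta.
    by rewrite leNgt; apply/negP => h; apply: no; exists n => //; exact: ltW.
  have Pp : 0 < P n by exact: lt_le_trans (P_ge1 n).
  have Ap : 0 < A by lra.
  rewrite -(@ler_ln R) ?posrE ?mulr_gt0 ?exprn_gt0 ?powR_gt0 //; last first.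
    by rewrite (lt_le_trans _ (a_ge1 n)).
  rewrite lnM ?posrE ?exprn_gt0 ?powR_gt0 // ln_powR lnXn // -/al => h.
  by apply: (le_trans h); rewrite /u -[al *+ _]mulr_natl -[n.+1%:R]natr1; lra.
have u0 n : 0 <= u n.
  by rewrite /u addr_ge0 ?mulr_ge0 // ln_ge0.
have uS n : (N <= n)%N -> u n.+1 <= g * (u n + al).
  move=> Nn; have := digit n Nn => h.
  have Pp : 0 < P n by exact: lt_le_trans (P_ge1 n).
  have ap : 0 < a n by exact: lt_le_trans (a_ge1 n).
  rewrite {1}/u PS lnM ?posrE // -natr1.
  have : theta * ln (a n) <= theta * (u n + al) by apply: ler_wpM2l.
  rewrite /g /u; lra.
have ubound j : u (N + j)%N <= (u N + al * j%:R) * g ^+ (N + j).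
  elim: j => [|j IH].
    by rewrite addn0 mulr0 addr0 ler_peMr // exprn_ege1.
  rewrite addnS; apply: (le_trans (uS _ (leq_addr _ _))).
  have gj : 1 <= g ^+ (N + j) by rewrite exprn_ege1.
  rewrite exprS [leRHS]mulrCA ler_wpM2l //; first lra.
  apply: (le_trans (lerD IH (lexx _))); rewrite -natr1.
  have : al <= al * g ^+ (N + j) by rewrite ler_peMr.
  lra.
set D := u N + al; have D0 : 0 <= D by rewrite addr_ge0.
have abound n : (N <= n)%N -> ln (a n) <= D * n.+1%:R * g ^+ n.+1.
  move=> Nn; apply: (le_trans (digit n Nn)).
  have gn : 1 <= g ^+ n by rewrite exprn_ege1.
  have := ubound (n - N)%N; rewrite subnKC // => h.
  have nN : (n - N)%:R <= n%:R :> R by rewrite ler_nat leq_subr.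
  have h1 : al * (n - N)%:R <= al * n%:R by apply: ler_wpM2l.
  have h2 : u N + al * (n - N)%:R + al <= D * n.+1%:R.
    rewrite -natr1 /D; have : 0 <= u N * n%:R by rewrite mulr_ge0.
    lra.
  have h3 : u n + al <= (u N + al * (n - N)%:R + al) * g ^+ n.
    have : al <= al * g ^+ n by rewrite ler_peMr.
    lra.
  apply: (le_trans h3); apply: ler_pM => //.
  - by have := u0 N; have : 0 <= al * (n - N)%:R by [rewrite mulr_ge0]; lra.
  - lra.
  - by rewrite exprS ler_peMl // (le_trans ler01).
pose T : R := \sum_(i < m) t i.
have T0 : 0 <= T by apply: sumr_ge0 => i _; exact: ltW.
(* C absorbs the shift by i < m within a window, through n + i <= n (1 + m) and g^(n + i) <= g^n
   g^m, and the sum T of the exponents. *)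
pose C := T * (D * (1 + m%:R) * g ^+ m).
have window n : (N < n)%N ->
    ln (\prod_(i < m) (partial_quotient (n + i) x)%:R `^ t i) <= C * n%:R * g ^+ n.
  move=> Nn.
  have -> : ln (\prod_(i < m) (partial_quotient (n + i) x)%:R `^ t i) =
      \sum_(i < m) t i * ln (partial_quotient (n + i) x)%:R.
    apply: expR_inj; rewrite lnK ?posrE; last first.
      apply: prodr_gt0 => i _; apply: powR_gt0.
      by rewrite ltr0n partial_quotient_gt0 // addn_gt0 (leq_trans _ Nn).
    rewrite expR_sum; apply: eq_bigr => i _; rewrite /powR gt_eqF //.
    by rewrite ltr0n partial_quotient_gt0 // addn_gt0 (leq_trans _ Nn).
  have -> : C * n%:R * g ^+ n = T * (D * (1 + m%:R) * g ^+ m * (n%:R * g ^+ n)).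
    by rewrite /C; ring.
  rewrite mulr_suml; apply: ler_sum => i _.
  apply: ler_wpM2l; first exact: ltW.
  case: n Nn => // n Nn; rewrite addSn.
  apply: (le_trans (abound (n + i)%N _)); first by rewrite (leq_trans _ (leq_addr _ _)).
  have im : (i <= m)%N by exact: ltnW.
  rewrite [leRHS](_ : _ = (D * (n.+1%:R * (1 + m%:R))) * (g ^+ n.+1 * g ^+ m)); last by ring.
  apply: ler_pM.
  - by rewrite mulr_ge0.
  - by rewrite exprn_ge0 // (le_trans ler01).
  - apply: ler_wpM2l => //; rewrite -(natrD _ 1) -natrM ler_nat.
    by rewrite mulnDr muln1 -addSn leq_add // (leq_trans im) // leq_pmull.
  - by rewrite -exprD; apply: ler_weXn2l => //; rewrite -addSn leq_add2l.
have [N' HN'] := growth C.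
have [n Nn [n0 Pn]] := (infinite_setP_nat _).1 infx (maxn N.+1 N').
move: Nn; rewrite geq_max => /andP[Nn N'n].
have := HN' n N'n; rewrite ltNge => /negP; apply.
apply: le_trans (window n Nn); rewrite ler_ln ?posrE //.
  exact: lt_le_trans (Psi_ge1 n0).
exact: lt_le_trans (lt_le_trans ltr01 (Psi_ge1 n0)) Pn.
Qed.

End Digits.

(** * Growth rates extracted from logarithmic inequalities *)

Section LogarithmicRates.
Variable R : realType.
Implicit Types (p e g C : R).

Lemma lne_divn p n : 1 <= p -> (0 < n)%N ->
  (lne p%:E / n%:R%:E = (ln p / n%:R)%:E)%E.
Proof.
move=> p1 n0; rewrite lne_EFin; last exact: lt_le_trans p1.
by rewrite inver pnatr_eq0 eqn0Ngt n0.
Qed.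

Lemma expn_lt_ln p e n : 1 <= p -> 0 < e -> (0 < n)%N ->
  ((ln e)%:E < lne (lne p%:E) / n%:R%:E)%E -> e ^+ n < ln p.
Proof.
move=> p1 e0 n0; have nR : 0 < n%:R :> R by rewrite ltr0n.
rewrite lne_EFin; last exact: lt_le_trans p1.
(* When p = 1 the iterated logarithm is -oo, which contradicts the lower bound assumed. *)
have [l0|l0] := leP (ln p) 0.
  by rewrite le0_lneNy ?lee_fin // inver gt_eqF // gt0_mulNye ?lte_fin ?invr_gt0.
rewrite lne_EFin // inver gt_eqF // -EFinM lte_fin ltr_pdivlMr // => h.
by rewrite -[ltRHS]lnK ?posrE // -[X in X ^+ _]lnK ?posrE // -expRM_natr ltr_expR.
Qed.

Lemma ln_lt_expn p e n : 1 <= p -> 0 < e -> (0 < n)%N ->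
  (lne (lne p%:E) / n%:R%:E < (ln e)%:E)%E -> ln p < e ^+ n.
Proof.
move=> p1 e0 n0; have nR : 0 < n%:R :> R by rewrite ltr0n.
rewrite lne_EFin; last exact: lt_le_trans p1.
have [l0 _|l0] := leP (ln p) 0; first by rewrite (le_lt_trans l0) // exprn_gt0.
rewrite lne_EFin // inver gt_eqF // -EFinM lte_fin ltr_pdivrMr // => h.
by rewrite -[ltLHS]lnK ?posrE // -[X in X ^+ _]lnK ?posrE // -expRM_natr ltr_expR.
Qed.

(** With r = e / g > 1, the quadratic term of the exponential series gives r^n >= (n ln r)^2 / 2,
    and this is at least C n once n >= 2 |C| / (ln r)^2. *)
Lemma expn_dominates C g e : 1 <= g -> g < e ->
  exists N, forall n, (N <= n)%N -> C * n%:R * g ^+ n <= e ^+ n.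
Proof.
move=> g1 ge; have g0 : 0 < g by lra.
set r := e / g; have r1 : 1 < r by rewrite ltr_pdivlMr // mul1r.
have l0 : 0 < ln r by exact: ln_gt0.
set y := `|C| * 2 / ln r ^+ 2.
have y0 : 0 <= y by rewrite divr_ge0 ?exprn_ge0 ?mulr_ge0 // ltW.
exists (Num.truncn y).+1 => n Nn.
have yn : y <= n%:R.
  have /andP[_ h] := truncn_itv y0; rewrite ltW // (lt_le_trans h) // ler_nat.
  exact: Nn.
have eE : e ^+ n = r ^+ n * g ^+ n by rewrite -exprMn /r divfK // gt_eqF.
rewrite eE ler_pM2r ?exprn_gt0 //.
have -> : r ^+ n = expR (n%:R * ln r) by rewrite expRM_natl lnK // posrE; lra.
have nl0 : 0 <= n%:R * ln r by rewrite mulr_ge0 // ltW.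
apply: le_trans (expR_ge1Dxn 1 nl0).
have : y * ln r ^+ 2 <= n%:R * ln r ^+ 2 by rewrite ler_pM2r ?exprn_gt0.
rewrite /y divfK ?lt0r_neq0 ?exprn_gt0 // => h.
have h2 : n%:R * (`|C| * 2) <= n%:R * (n%:R * ln r ^+ 2) by apply: ler_wpM2l.
have h3 : C * n%:R <= `|C| * n%:R by apply: ler_wpM2r => //; exact: ler_norm.
rewrite (_ : 2`! = 2)%N // exprMn expr2; lra.
Qed.

End LogarithmicRates.

(** * Dimension bounds in terms of the growth of Psi *)

Section Dimension.
Variables (R : realType) (m : nat) (t : 'I_m -> R) (Psi : nat -> R).
Hypothesis m_ge1 : (1 <= m)%N.
Hypothesis t_gt0 : forall i, 0 < t i.
Hypothesis Psi_ge1 : forall n, (1 <= n)%N -> 1 <= Psi n.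

Let i0 : 'I_m := Ordinal m_ge1.

Lemma limsup_product_set_often (x : R) : 0 <= x < 1 -> irrational x ->
  (forall N, exists2 n, (N <= n)%N &
     (0 < n)%N /\ Psi n <= (partial_quotient n x)%:R `^ t i0) ->
  limsup_product_set t Psi x.
Proof.
move=> x01 irx often; split => //; apply/infinite_setP_nat => N.
have [n Nn [n0 Pn]] := often N; exists n => //; split => //.
apply: (le_trans Pn); rewrite -{1}(addn0 n).
exact: (le_window_prod t_gt0 i0 x01 irx n0).
Qed.

Lemma dim_limsup_product_set_slow :
  (forall e : R, 0 < e -> forall N, exists2 n, (N <= n)%N &
     (0 < n)%N /\ ln (Psi n) < e * n%:R) ->
  (hausdorff_dim (limsup_product_set t Psi) = 1)%E.
Proof.
move=> slow; apply/eqP; rewrite eq_le; apply/andP; split.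
  by apply: hausdorff_dim_unit_interval => x [].
have t0 : 0 < t i0 by [].
(* A digit a_(n+1) = [A n] makes a_(n+1)^(t_0) at least Psi(n + 1), so the first position of the
   window alone gives membership. *)
pose A n : nat := (Num.truncn (Psi n.+1 `^ (t i0)^-1)).+1.
have Psi1 n : 1 <= Psi n.+1 `^ (t i0)^-1.
  rewrite -(powRr0 (Psi n.+1)); apply: ler_powR; first exact: Psi_ge1.
  by rewrite invr_ge0 ltW.
have A_bounds n : Psi n.+1 `^ (t i0)^-1 <= (A n)%:R <= Psi n.+1 `^ (t i0)^-1 + 1.
  have /andP[h1 h2] := truncn_itv (le_trans ler01 (Psi1 n)).
  by rewrite (ltW h2) /= /A -natr1 lerD2r.
have A_small (e : R) : 0 < e -> forall N, exists2 n, (N <= n)%N &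
    (A n)%:R + 2 <= expR (e * n.+1%:R).
  move=> e0 N; set e2 := e / 2 * t i0.
  have e20 : 0 < e2 by rewrite mulr_gt0 // divr_gt0.
  (* The rate [e2] yields Psi(n)^(1 / t_0) <= exp(e n / 2), and n >= 6 / e yields exp(e n / 2) >= 4,
     which pays for the additive constants because x + 3 <= 4 x when x >= 1. *)
  have [n Nn [n0 Pn]] := slow e2 e20 (maxn N.+1 (Num.truncn (6 / e)).+1).
  case: n n0 Nn Pn => // n _ Nn Pn.
  exists n; first by rewrite -ltnS (leq_trans (leq_maxl _ _) Nn).
  have nn := leq_trans (leq_maxr _ _) Nn.
  have /andP[_ An] := A_bounds n.
  have P0 : 0 < Psi n.+1 by exact: lt_le_trans (Psi_ge1 _).
  have e60 : 0 <= 6 / e by rewrite divr_ge0 // ltW.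
  have ne : 6 <= e * n.+1%:R.
    rewrite mulrC -ler_pdivrMr //; have /andP[_ h] := truncn_itv e60.
    by rewrite ltW // (lt_le_trans h) // ler_nat.
  have h4 : 4 <= expR (e * n.+1%:R / 2).
    apply: le_trans (expR_ge1Dx _); lra.
  have hP : Psi n.+1 `^ (t i0)^-1 <= expR (e * n.+1%:R / 2).
    rewrite /powR gt_eqF // ler_expR mulrC ler_pdivrMr //.
    by apply: (le_trans (ltW Pn)); rewrite /e2; lra.
  apply: (@le_trans _ _ (4 * Psi n.+1 `^ (t i0)^-1)); first by have := Psi1 n; lra.
  have -> : e * n.+1%:R = e * n.+1%:R / 2 + e * n.+1%:R / 2 by lra.
  by rewrite expRD; apply: ler_pM => //; exact: powR_ge0.
apply/lee_subgt0Pr => e e0; rewrite -EFinB.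
have [e1|e1] := leP 1 e.
  apply: (@le_trans _ _ 0%:E); first by rewrite lee_fin; lra.
  by apply: le_ereal_inf_tmp => _ [s [s0 _] <-]; rewrite lee_fin.
apply: (@sparse_digits_dim _ A) => //; [lra|lra|].
move=> x x01 irx often; apply: limsup_product_set_often => // N.
have [n Nn xn] := often N; exists n.+1; first exact: leqW.
split => //; rewrite xn; have /andP[h _] := A_bounds n.
have -> : Psi n.+1 = (Psi n.+1 `^ (t i0)^-1) `^ t i0.
  by rewrite -powRrM mulVf ?lt0r_neq0 // powRr1 // (le_trans ler01) // Psi_ge1.
by apply: ge0_ler_powR; rewrite ?nnegrE ?powR_ge0 // ltW.
Qed.

Lemma dim_limsup_product_set_ge (d s : R) : 1 < d -> 0 < s -> s * (1 + d) < 1 ->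
  (forall N, exists2 n, (N <= n)%N & (0 < n)%N /\ ln (Psi n) < d ^+ n) ->
  (s%:E <= hausdorff_dim (limsup_product_set t Psi))%E.
Proof.
move=> d1 s0 sd often; have t0 : 0 < t i0 by [].
have eta0 : 0 < 1 - s * (1 + d) by lra.
(* k >= 1 / t_0 turns digits of size exp(k d^n) into powers at least exp(d^n) > Psi(n); the last
   term is the requirement of [fast_digits_dim]. *)
pose k := Num.max 1 (Num.max (t i0)^-1 (s * ln 4 / (1 - s * (1 + d)))).
have [k1 kt ks] : [/\ 1 <= k, (t i0)^-1 <= k & s * ln 4 / (1 - s * (1 + d)) <= k].
  by rewrite /k !le_max !lexx !orbT.
apply: (@fast_digits_dim _ d k) => //.
  by rewrite [leRHS]mulrC -ler_pdivrMr.
move=> x x01 irx xk; apply: limsup_product_set_often => // N.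
have [n Nn [n0 Pn]] := often N.
case: n n0 Nn Pn => // n _ Nn Pn; exists n.+1 => //; split => //.
have P0 : 0 < Psi n.+1 by exact: lt_le_trans (Psi_ge1 _).
rewrite -[leLHS]lnK ?posrE //; apply: (@le_trans _ _ (expR (k * d ^+ n.+1) `^ t i0)).
  rewrite -expRM ler_expR; apply: (le_trans (ltW Pn)).
  rewrite mulrAC ler_peMl ?exprn_ge0 //; first lra.
  by rewrite -ler_pdivrMr // mul1r.
by apply: ge0_ler_powR; rewrite ?nnegrE ?expR_ge0 // ltW.
Qed.

Lemma dim_limsup_product_set_le (theta s : R) : 0 < s -> 0 <= theta ->
  1 < s * (2 + theta) ->
  (forall C : R, exists N, forall n, (N <= n)%N ->
     C * n%:R * (1 + theta) ^+ n < ln (Psi n)) ->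
  (hausdorff_dim (limsup_product_set t Psi) <= s%:E)%E.
Proof.
move=> s0 th0 st growth; apply: (large_digits_dim_le s0 th0 st).
exact: limsup_product_set_large_digits.
Qed.

End Dimension.

(** * From the growth rates B and b to the dimension *)

Local Open Scope ereal_scope.

Theorem theorem1p5 (R : realType) (m : nat) (t : 'I_m -> R) (Psi : nat -> R)
    (B b : \bar R)
    (m_ge1 : (1 <= m)%N)
    (t_gt0 : forall i, (0 < t i)%R)
    (Psi_ge1 : forall n, (1 <= n)%N -> (1 <= Psi n)%R)
    (B_ge0 : 0 <= B)
    (logB : lne B = limn_einf (fun n => lne (Psi n)%:E / n%:R%:E))
    (b_ge0 : 0 <= b)
    (logb : lne b = limn_einf (fun n => lne (lne (Psi n)%:E) / n%:R%:E)) :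
  (B = 1 -> hausdorff_dim (limsup_product_set t Psi) = 1) /\
  (B = +oo -> hausdorff_dim (limsup_product_set t Psi) = (1 + b)^-1).
Proof.
split=> BE; rewrite {}BE in logB {B_ge0}.
  apply: dim_limsup_product_set_slow => // e e0 N.
  have lt_e : limn_einf (fun n => lne (Psi n)%:E / n%:R%:E) < e%:E.
    by rewrite -logB lne1 lte_fin.
  have [n] := limn_einf_lt lt_e (maxn N 1).
  rewrite geq_max => /andP[Nn n0] h; exists n => //; split => //.
  by move: h; rewrite lne_divn ?Psi_ge1 // lte_fin ltr_pdivrMr // ltr0n.
have growth C : exists N, forall n, (N <= n)%N -> (C * n%:R < ln (Psi n))%R.
  have [|N HN] := @lt_limn_einf _ (fun n => lne (Psi n)%:E / n%:R%:E) C%:E.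
    by rewrite -logB ltry.
  exists N.+1 => n Nn; have n0 : (0 < n)%N by exact: leq_ltn_trans Nn.
  have := HN n (ltnW Nn).
  by rewrite lne_divn ?Psi_ge1 // lte_fin ltr_pdivlMr // ltr0n.
(* If log b were negative, ln Psi(n) < 1 would hold infinitely often, against the superlinear growth
   that B = oo provides. *)
have b1 : 1 <= b.
  rewrite -lne_ge0 leNgt; apply/negP; rewrite logb => neg.
  have [N HN] := growth 1%R.
  have [n] := limn_einf_lt neg (maxn N 1); rewrite geq_max => /andP[Nn n0].
  have zE : 0 = (ln (1 : R)%R)%:E by rewrite ln1.
  rewrite [X in _ < X]zE.
  move=> /(ln_lt_expn (Psi_ge1 _ n0) ltr01 n0); rewrite expr1n ltNge => /negP; apply.
  by rewrite (le_trans _ (ltW (HN n Nn))) // mul1r ler1n.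
(* For theta = 0 the superlinear growth suffices; this alternative covers b = 1, where no theta >= 0
   satisfies 1 + theta < b. *)
have upper theta s : (0 < s)%R -> (0 <= theta)%R -> (1 < s * (2 + theta))%R ->
    theta = 0%R \/ (1 + theta)%:E < b ->
    hausdorff_dim (limsup_product_set t Psi) <= s%:E.
  move=> s0 th0 st thb; apply: (dim_limsup_product_set_le t_gt0 Psi_ge1 s0 th0 st) => C.
  case: thb => [->|thb].
    have [N HN] := growth C; exists N => n Nn.
    by rewrite addr0 expr1n mulr1 HN.
  (* Room between 1 + theta and b is used twice: e^n < ln Psi(n) eventually, and e^n dominates C n
     (1 + theta)^n. *)
  have [e the eb] : exists2 e, (1 + theta < e)%R & e%:E < b.
    case: (b) thb => [r| |//]; rewrite ?lte_fin => h; last first.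
      by exists (1 + theta + 1)%R; rewrite ?ltry //; lra.
    by exists ((1 + theta + r) / 2)%R; rewrite ?lte_fin; lra.
  have e0 : (0 < e)%R by lra.
  have [|N HN] := @lt_limn_einf _ (fun n => lne (lne (Psi n)%:E) / n%:R%:E) (ln e)%:E.
    by rewrite -logb -lne_EFin // lte_lne // in_itv /= ?leey ?lee_fin ?andbT // ltW.
  have th1 : (1 <= 1 + theta)%R by rewrite lerDl.
  have [N' HN'] := expn_dominates C th1 the.
  exists (maxn (maxn N N') 1) => n; rewrite !geq_max => /andP[/andP[Nn N'n] n0].
  by apply: le_lt_trans (HN' n N'n) _; apply: expn_lt_ln (HN n Nn); rewrite ?Psi_ge1.
apply/eqP; rewrite eq_le; apply/andP; split.
  case: b b1 logb b_ge0 upper => [beta| |//] b1 _ _ upper; last first.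
    rewrite addey // invey; apply/lee_addgt0Pr => s s0; rewrite add0e.
    (* With theta = 1 / s one has s (2 + theta) = 2 s + 1 > 1 for every s > 0, so the dimension is
       0. *)
    apply: (upper (s^-1)%R) => //; rewrite ?invr_ge0 ?(ltW s0) ?ltry //; last by right.
    by rewrite mulrDr mulfV ?lt0r_neq0 // ltrDr mulr_gt0.
  rewrite lee_fin in b1; have b2 : (0 < 1 + beta)%R by lra.
  rewrite -EFinD inver gt_eqF //; apply/lee_addgt0Pr => e e0; rewrite -EFinD.
  set s := ((1 + beta)^-1 + e)%R.
  have s0 : (0 < s)%R by rewrite addr_gt0 ?invr_gt0.
  have sb : (1 < s * (1 + beta))%R by rewrite mulrDl mulVf ?gt_eqF // ltrDl mulr_gt0.
  have [s2|s2] := ltP 1%R (s * 2)%R.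
    by apply: (upper 0%R) => //; [rewrite addr0|left].
  have si : (s^-1 - 1 < beta)%R.
    rewrite ltrBlDl -(ltr_pM2l s0) mulfV ?gt_eqF //.
  have si1 : (1 <= s^-1 - 1)%R.
    rewrite lerBrDl -(ler_pM2l s0) mulfV ?gt_eqF //.
  (* 1 + theta is the midpoint of 1 / s - 1 and beta, both at least 1; thus theta >= 0, 1 + theta <
     beta and s (2 + theta) > 1. *)
  pose theta := ((s^-1 - 1 + beta) / 2 - 1)%R.
  apply: (upper theta) => //; first by rewrite /theta; lra.
    have : (s^-1 < 2 + theta)%R by rewrite /theta; lra.
    by move=> st; rewrite -[ltLHS](mulfV (lt0r_neq0 s0)) ltr_pM2l.
  by right; rewrite lte_fin /theta; lra.
case: b b1 logb b_ge0 {upper} => [beta| |//] b1 logb _; last first.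
  rewrite addey // invey; apply: le_ereal_inf_tmp => _ [s [s0 _] <-].
  by rewrite lee_fin.
rewrite lee_fin in b1; have b2 : (0 < 1 + beta)%R by lra.
rewrite -EFinD inver gt_eqF //; apply/lee_subgt0Pr => e e0; rewrite -EFinB.
set s := ((1 + beta)^-1 - e)%R.
have [s0|s0] := leP s 0%R.
  apply: (@le_trans _ _ 0%:E); first by rewrite lee_fin.
  by apply: le_ereal_inf_tmp => _ [r [r0 _] <-]; rewrite lee_fin.
have sb : (s * (1 + beta) < 1)%R by rewrite mulrBl mulVf ?gt_eqF // gtrBl mulr_gt0.
have si : (beta < s^-1 - 1)%R.
  by rewrite ltrBrDl -(ltr_pM2l s0) mulfV ?gt_eqF.
(* The midpoint of beta and 1 / s - 1: d > beta makes ln Psi(n) < d^n infinitely often, and d < 1 /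
   s - 1 gives s (1 + d) < 1. *)
pose d := ((s^-1 - 1 + beta) / 2)%R.
have d1 : (1 < d)%R by rewrite /d; lra.
apply: (dim_limsup_product_set_ge m_ge1 t_gt0 Psi_ge1 d1 s0).
  have : (1 + d < s^-1)%R by rewrite /d; lra.
  by move=> ds; rewrite -[ltRHS](mulfV (lt0r_neq0 s0)) ltr_pM2l.
move=> N; have d0 : (0 < d)%R by lra.
have lt_d : limn_einf (fun n => lne (lne (Psi n)%:E) / n%:R%:E) < (ln d)%:E.
  rewrite -logb -lne_EFin // lte_lne ?in_itv /= ?leey ?lee_fin ?andbT ?(ltW d0) //; last by lra.
  by rewrite lte_fin /d; lra.
have [n] := limn_einf_lt lt_d (maxn N 1).
rewrite geq_max => /andP[Nn n0] h; exists n => //; split => //.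
by apply: ln_lt_expn h; rewrite ?Psi_ge1.
Qed.
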